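(* Assume the language is countable, and work in a monster model $\mathfrak{C}$ of a complete theory. Suppose that $G$ is a $\emptyset$-definable group and $H\leq G$ is an invariant subgroup of bounded index. Suppose in addition that $K\geq H$ is a type-definable (with parameters) subgroup of $G$. Then $E_H\restriction_K$ is smooth if and only if $H$ is type-definable, where $E_H$ is the relation on $G$ of lying in the same right coset of $H$.
   Context: A monster model is a model that is $\kappa$-saturated and strongly $\kappa$-homogeneous for a sufficiently large strong limit cardinal $\kappa$; ''small'' means of cardinality less than $\kappa$. Groups and subgroups are identified with their sets of points in $\mathfrak{C}$. ''Invariant'' means invariant under $\mathrm{Aut}(\mathfrak{C})$; ''type-definable'' means type-definable over a small set of parameters. Bounded index means index less than $\kappa$. For a model $M\prec\mathfrak{C}$ and an $M$-invariant set $Z$, $Z_M:=\{\mathrm{tp}(a/M):a\in Z\}$. $E_H^M$ is the equivalence relation on $G_M$ given by: $p\mathrel{E_H^M}q$ iff there are $a\models p$, $b\models q$ with $a\mathrel{E_H}b$ (equivalently, for all such $a,b$); every union of $E_H$-classes (in particular $K$) is $M$-invariant. $E_H\restriction_K$ is smooth if $E_H^M\restriction_{K_M}$ is smooth for a countable model $M\prec\mathfrak{C}$ (this does not depend on the choice of countable $M$). An equivalence relation $F$ on a Polish space $W$ (not assumed Borel) is smooth if there is a Borel function $g\colon W\to 2^{\mathbb{N}}$ with $x\mathrel{F}y\iff g(x)=g(y)$. *)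

(* Defs.v *)
From HB Require Import structures.
From mathcomp Require Import all_boot.
From mathcomp Require Import all_classical.
From mathcomp Require Import topology cantor measurable_structure.

Set Implicit Arguments.
Unset Strict Implicit.
Unset Printing Implicit Defensive.

Local Open Scope classical_set_scope.
Local Open Scope card_scope.

(* Constants are function symbols of arity 0. *)
Record language := Language {
  fun_symbol : Type; fun_arity : fun_symbol -> nat;
  rel_symbol : Type; rel_arity : rel_symbol -> nat }.

Definition countable_language (L : language) : Prop :=
  countable [set: fun_symbol L] /\ countable [set: rel_symbol L].

Section Syntax.
Variable L : language.

Inductive term (V : Type) : Type :=
| TVar of V
| TApp (f : fun_symbol L) of ('I_(fun_arity f) -> term V).

(* Formulas with free variables in [V]; the body of a quantifier has one extra
   variable, [None].  An L-formula with parameters from [A] in the variables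
   [I] is a [formula (I + A)], each parameter being a variable that is always
   interpreted by itself (see [pval]). *)
Inductive formula (V : Type) : Type :=
| FBot
| FEq of term V & term V
| FRel (r : rel_symbol L) of ('I_(rel_arity r) -> term V)
| FImp of formula V & formula V
| FAll of formula (option V).

Definition FNot (V : Type) (phi : formula V) : formula V := FImp phi (FBot V).

Record structure (U : Type) := Structure {
  fun_interp : forall f : fun_symbol L, ('I_(fun_arity f) -> U) -> U;
  rel_interp : forall r : rel_symbol L, ('I_(rel_arity r) -> U) -> Prop;
  structure_inhabited : inhabited U }.

Section Semantics.
Variables (U : Type) (C : structure U).

Fixpoint eval (V : Type) (v : V -> U) (t : term V) : U :=
  match t with
  | TVar x => v x
  | TApp f ts => fun_interp C (fun i => eval v (ts i))
  end.

Fixpoint sat (V : Type) (phi : formula V) : (V -> U) -> Prop :=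
  match phi with
  | FBot => fun=> False
  | FEq s t => fun v => eval v s = eval v t
  | FRel r ts => fun v => rel_interp C (fun i => eval v (ts i))
  | FImp phi psi => fun v => sat phi v -> sat psi v
  | FAll phi => fun v => forall x : U, sat phi (oapp v x)
  end.

Definition pval (I : Type) (A : set U) (x : I -> U) (z : I + A) : U :=
  match z with inl i => x i | inr a => set_val a end.

Definition definable0 (I : Type) (X : set (I -> U)) : Prop :=
  exists phi : formula I, forall x, X x <-> sat phi x.

(* The complete n-types over [A].  A set of formulas over [A] is consistent with
   the theory of [C] with names for [A] iff it is finitely satisfiable in [C]. *)
Record type_space (n : nat) (A : set U) := TypeSpace {
  type_formulas :> formula ('I_n + A) -> Prop;
  type_fin_sat : forall F, finite_set F -> F `<=` type_formulas ->
    exists x : 'I_n -> U, forall phi, F phi -> sat phi (pval x);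
  type_complete : forall phi, type_formulas phi \/ type_formulas (FNot phi) }.

Definition realizes (n : nat) (A : set U) (x : 'I_n -> U)
    (p : type_space n A) : Prop :=
  forall phi, p phi -> sat phi (pval x).

Section tp.
Variables (n : nat) (A : set U) (x : 'I_n -> U).
Let ph : set (formula ('I_n + A)) := [set phi | sat phi (pval x)].

Fact tp_fin_sat F : finite_set F -> F `<=` ph ->
  exists y : 'I_n -> U, forall phi, F phi -> sat phi (pval y).
Proof. by move=> _ Fph; exists x => phi /Fph. Qed.

Fact tp_complete phi : ph phi \/ ph (FNot phi).
Proof. exact: EM. Qed.

Definition tp : type_space n A := TypeSpace tp_fin_sat tp_complete.
End tp.

Section Stone.
Variables (n : nat) (A : set U).
HB.instance Definition _ := gen_eqMixin (type_space n A).
HB.instance Definition _ := gen_choiceMixin (type_space n A).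

(* The Stone topology; this subbase is in fact a base of clopen sets. *)
HB.instance Definition _ := isSubBaseTopological.Build (type_space n A)
  (range (fun phi => [set p : type_space n A | p phi])) id.
End Stone.

Definition types_of (n : nat) (M : set U) (Z : set ('I_n -> U)) :
    set (type_space n M) :=
  [set tp M a | a in Z].

Definition automorphism (s : U -> U) : Prop :=
  [/\ bijective s,
      forall (f : fun_symbol L) x,
        s (fun_interp C (f := f) x) = fun_interp C (s \o x)
    & forall (r : rel_symbol L) x,
        rel_interp C (r := r) (s \o x) <-> rel_interp C x].

Definition aut_invariant (I : Type) (X : set (I -> U)) : Prop :=
  forall s, automorphism s -> forall x, X (s \o x) <-> X x.

Definition elementary_on (A : set U) (f : U -> U) : Prop :=
  forall phi : formula A, sat phi set_val <-> sat phi (f \o set_val).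

End Semantics.

Definition elementary_submodel (U : Type) (C : structure U) (M : set U) :
    Prop :=
  exists D : structure M, forall (n : nat) (phi : formula 'I_n) (v : 'I_n -> M),
    sat D phi v <-> sat C phi (set_val \o v).

End Syntax.

Arguments types_of {L U} C {n} M Z.

Definition card_lt (T U : Type) (A : set T) (B : set U) : Prop :=
  A #<= B /\ ~ (B #<= A).

(* A cardinal is represented by a type [kappa] of that cardinality. *)
Definition small (kappa : Type) (T : Type) (A : set T) : Prop :=
  card_lt A [set: kappa].

(* For a countable language, "sufficiently large" is read as uncountable. *)
Definition uncountable_strong_limit (kappa : Type) : Prop :=
  small kappa [set: nat] /\
  forall A : set kappa, small kappa A -> small kappa [set B | B `<=` A].

Section Monster.
Variables (kappa : Type) (L : language) (U : Type) (C : structure L U).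

Definition saturated : Prop :=
  forall (n : nat) (A : set U), small kappa A ->
    forall p : type_space C n A, exists x, realizes x p.

Definition strongly_homogeneous : Prop :=
  forall (A : set U) (f : U -> U), small kappa A -> elementary_on C A f ->
    exists2 s, automorphism C s & {in A, s =1 f}.

Definition monster : Prop :=
  [/\ uncountable_strong_limit kappa, saturated & strongly_homogeneous].

Definition type_definable (I : Type) (X : set (I -> U)) : Prop :=
  exists (A : set U) (p : set (formula L (I + A))), small kappa A /\
    forall x, X x <-> forall phi, p phi -> sat C phi (pval x).

End Monster.

Section Group.
Variables (L : language) (U : Type) (C : structure L U) (n : nat).
Variables (G : groupType) (pt : G -> 'I_n -> U).

(* [G] is a group on a 0-definable set of n-tuples: [pt] identifies [G] with
   this set, and the graph of the multiplication is 0-definable. *)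
Definition definable_group : Prop :=
  [/\ injective pt,
      definable0 C (range pt)
    & definable0 C [set x : 'I_n + 'I_n + 'I_n -> U | exists a b : G,
        [/\ x \o inl \o inl = pt a, x \o inl \o inr = pt b
          & x \o inr = pt (a * b)%g]]].

Definition subgroup (H : set G) : Prop := group_closed (mem H).

Definition right_coset (H : set G) (c : G) : set G := [set (h * c)%g | h in H].

Definition bounded_index (kappa : Type) (H : set G) : Prop :=
  small kappa (range (right_coset H)).

Definition coset_rel (H : set G) (a b : G) : Prop :=
  exists c, right_coset H c a /\ right_coset H c b.

Definition coset_rel_types (H : set G) (M : set U) (p q : type_space C n M) :
    Prop :=
  exists a b, [/\ realizes (pt a) p, realizes (pt b) q & coset_rel H a b].

End Group.

Definition borel (W : topologicalType) : set (set W) := <<s @open W >>.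

Definition borel_fun (W Y : topologicalType) (g : W -> Y) : Prop :=
  forall B, borel B -> borel (g @^-1` B).

Definition smooth (W : topologicalType) (F : W -> W -> Prop) : Prop :=
  exists g : W -> cantor_space, borel_fun g /\ forall x y, F x y <-> g x = g y.

(* The relation E_H^M restricted to K_M = {tp(a/M) | a in K}, for a countable
   model [M]; whether it is smooth does not depend on the choice of [M].
   K_M carries the subspace topology, which is Polish in the intended setting
   ([M] a countable model, [K] type-definable and [M]-invariant). *)
Definition coset_rel_smooth (L : language) (U : Type) (C : structure L U)
    (n : nat) (G : groupType) (pt : G -> 'I_n -> U) (H K : set G) : Prop :=
  exists M : set U, [/\ countable M, elementary_submodel C M &
    smooth (fun p q : types_of C M (pt @` K) =>
      coset_rel_types pt H (set_val p) (set_val q))].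

(* Main.v *)
From mathcomp Require Import all_boot finmap.
From mathcomp Require Import all_classical.
From mathcomp Require Import topology cantor measurable_structure.
Require Import Defs.

(* Smooth implies type-definable.  Fix a countable model M for which the
   relation is smooth.  Cosets of H, and of its conjugates, are unions of types
   over M, so an ultrafilter p on G containing H has a limit type over M lying
   in a single coset H r(p), and H r(p * q) = H r(p) r(q) for the product of
   ultrafilters.  Work inside a minimal H-flow of ultrafilters containing H (a
   minimal left ideal of the Stone-Cech compactification of H).  Pullbacks of
   Borel sets have the Baire property there, and a 0-1 law holds for H-invariant
   sets, so smoothness makes the preimage of exactly one coset Hk comeager.
   Right multiplication by an element of the flow pulls comeager sets back to
   comeager sets; comparing x * r0 and x * q * r0, for r0 in the flow and generic
   x, yields k r(q) k^-1 in H for every q.  Taking for q an ultrafilter in the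
   comeager coset gives k in H, hence r(q) in H for every q: H contains the
   closure over M of itself, so it is type-definable over M.

   Conversely, if H is type-definable, then by compactness the saturation
   of a clopen set of types over a countable model is closed, and the countably
   many such saturations separate the classes. *)

Set Implicit Arguments.
Unset Strict Implicit.
Unset Printing Implicit Defensive.

Local Open Scope classical_set_scope.
Local Open Scope card_scope.

(** * Cardinality *)

Lemma inj_on_card_le (T U : Type) (A : set T) (B : set U) (f : T -> U) :
  (forall x, A x -> B (f x)) ->
  (forall x y, A x -> A y -> f x = f y -> x = y) -> A #<= B.
Proof.
move=> fAB finj; have fA : f @` A `<=` B by move=> _ [x Ax <-]; exact: fAB.
apply: card_le_trans (subset_card_le fA).
have finj' : {in A &, injective f}.
  by move=> x y /set_mem Ax /set_mem Ay; exact: finj.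
by rewrite (card_le_eqr (inj_card_eq finj')).
Qed.

Lemma card_le_inj_on (T U : Type) (u0 : U) (A : set T) (B : set U) :
  A #<= B -> exists f : T -> U, (forall x, A x -> B (f x)) /\
  (forall x y, A x -> A y -> f x = f y -> x = y).
Proof.
elim/Ppointed: U => U in u0 B *; first by case: (no u0).
move=> /pcard_leP[f]; exists f; split.
  by move=> x Ax; apply: funS.
by move=> x y Ax Ay; apply: inj; exact: mem_set.
Qed.

Lemma image_card_le (T U : Type) (A : set T) (B : set U) (f : U -> T) :
  A `<=` f @` B -> A #<= B.
Proof. by move=> /subset_card_le /card_le_trans; apply; exact: card_image_le. Qed.

Section Small.
Variable kappa : Type.
Hypothesis Hk : uncountable_strong_limit kappa.

Lemma strong_limit_inhab : inhabited kappa.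
Proof.
have [//|n] := EM (inhabited kappa).
have := Hk.1.1; rewrite (_ : [set: kappa] = set0).
  by rewrite card_le0 => /eqP/seteqP[/(_ 0)]; case.
by apply/seteqP; split=> // k _; case: n.
Qed.

Lemma small_le (T U : Type) (A : set T) (B : set U) :
  A #<= B -> small kappa B -> small kappa A.
Proof.
move=> AB [Bk kB]; split; first exact: card_le_trans Bk.
by move=> kA; apply: kB; exact: card_le_trans AB.
Qed.

Lemma small_countable (T : Type) (A : set T) : countable A -> small kappa A.
Proof. by move=> cA; exact: small_le cA Hk.1. Qed.

(** The strong limit hypothesis speaks of subsets of [kappa] only; an injection of [X] into [kappa]
    transports it. *)
Lemma small_pow (T : Type) (X : set T) :
  small kappa X -> small kappa [set B | B `<=` X].
Proof.
move=> sX; have [k0] := strong_limit_inhab.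
have [f [_ finj]] := card_le_inj_on k0 sX.1.
have sfX : small kappa (f @` X) by apply: (small_le _ sX); exact: card_image_le.
apply: (small_le _ (Hk.2 _ sfX)); apply: (inj_on_card_le (f := fun B => f @` B)).
  by move=> B BX _ [x Bx <-]; exists x => //; exact: BX.
have inc B B' : B `<=` X -> B' `<=` X -> f @` B `<=` f @` B' -> B `<=` B'.
  move=> BX BX' BB' x Bx; have [y B'y /finj <-//] := BB' _ (imageP f Bx).
    exact: BX'.
  exact: BX.
by move=> B B' BX BX' e; apply/seteqP; split; apply: inc => //; rewrite e.
Qed.

(** Kuratowski pairs embed [X * X] into the double power set of [X], so the strong limit property
    suffices and no cardinal multiplication is involved. *)
Lemma small_square (T : Type) (X : set T) :
  small kappa X -> small kappa (X `*` X).
Proof.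
move=> /small_pow/small_pow; apply: small_le.
apply: (inj_on_card_le (f := fun p => [set [set p.1]; [set p.1; p.2]])).
  by move=> [a b] /= [Xa Xb] _ [->|->] x /=; [move=> ->|case=> ->].
move=> [a b] [c d] /= _ _ e.
have ac : a = c.
  have : [set [set a]; [set a; b]] [set a] by left.
  rewrite e => -[] /seteqP[]; first by move=> /(_ a erefl).
  by move=> _ /(_ c); rewrite /= => h; rewrite h//; left.
subst c; congr (_, _).
have : [set [set a]; [set a; b]] [set a; d] by rewrite e; right.
have : [set [set a]; [set a; d]] [set a; b] by rewrite -e; right.
case=> /seteqP[h1 h2] [] /seteqP[h3 h4].
- have hb : b = a by apply: h1; right.
  by have := h3 d (or_intror erefl) => /= ->.
- have hb : b = a by apply: h1; right.
  by have [|] := h3 d (or_intror erefl) => /= ->.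
- have hb : d = a by apply: h3; right.
  by have [|] := h1 b (or_intror erefl) => /= ->.
- have [hb|//] : b = a \/ b = d by apply: h1; right.
  by have [|] := h3 d (or_intror erefl) => /= ->.
Qed.

(** If [D] is infinite, each countable piece injects into [D]. A point is then determined by the
    index of a piece containing it and its code in that piece, so the union embeds in the square of
    [D]. *)
Lemma small_bigcup (I T : Type) (D : set I) (F : I -> set T) :
  small kappa D -> (forall i, D i -> countable (F i)) ->
  small kappa (\bigcup_(i in D) F i).
Proof.
move=> sD cF.
have [finD|/infiniteP natD] := EM (finite_set D).
  by apply: small_countable; apply: bigcup_countable => //;
      exact: finite_set_countable.
apply: (small_le _ (small_square sD)).
have /choice[u Hu] (x : T) : exists i, (\bigcup_(i in D) F i) x -> D i /\ F i x.
  have [[i Di Fix]|n] := EM ((\bigcup_(i in D) F i) x); first by exists i.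
  by have [i _] := infinite_setN0 ((infiniteP _).2 natD); exists i.
have /choice[c Hc] (i : I) : exists f : T -> I, D i ->
    (forall x, F i x -> D (f x)) /\
      (forall x y, F i x -> F i y -> f x = f y -> x = y).
  have [Di|n] := EM (D i); last by exists (fun=> i).
  have [f Hf] := card_le_inj_on i (card_le_trans (cF i Di) natD).
  by exists f.
apply: (inj_on_card_le (f := fun x => (u x, c (u x) x))).
  by move=> x /Hu[Dx Fx]; split => //=; have [h _] := Hc _ Dx; exact: h.
move=> x y /Hu[Dx Fx] /Hu[Dy Fy] [e]; rewrite -e in Fy *.
by have [_ h] := Hc _ Dx; exact: h.
Qed.

Lemma small_setU_countable (T : Type) (A B : set T) :
  small kappa A -> countable B -> small kappa (A `|` B).
Proof.
move=> sA cB; have [[a Aa]|nA] := EM (A !=set0); last first.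
  apply: small_countable; apply: sub_countable cB; apply: subset_card_le =>
    x [Ax|//].
  by case: nA; exists x.
(* For nonempty [A] the union becomes a small union of countable sets. *)
have -> : A `|` B = \bigcup_(i in A) ([set i] `|` B).
  apply/seteqP; split=> x.
    by case=> [Ax|Bx]; [exists x => //; left|exists a => //; right].
  by case=> i Ai [->|Bx]; [left|right].
apply: small_bigcup => // i _.
have -> : [set i] `|` B = \bigcup_(b in [set: bool]) (if b then [set i] else B).
  apply/seteqP; split=> x; first by case=> h; [exists true|exists false].
  by case=> -[] _ h; [left|right].
by apply: bigcup_countable => // -[] _ //; exact: countable1.
Qed.

End Small.

(** * Renaming of variables *)

Section Renaming.
Variable L : language.

Fixpoint tmap (V W : Type) (f : V -> W) (t : term L V) : term L W :=
  match t with
  | TVar x => TVar L (f x)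
  | TApp g ts => TApp (fun i => tmap f (ts i))
  end.

Fixpoint formula_map (V : Type) (phi : formula L V) (W : Type) (f : V -> W) :
    formula L W :=
  match phi with
  | FBot => FBot L W
  | FEq s t => FEq (tmap f s) (tmap f t)
  | FRel r ts => FRel (fun i => tmap f (ts i))
  | FImp phi psi => FImp (formula_map phi f) (formula_map psi f)
  | FAll phi => FAll (formula_map phi (omap f))
  end.

Lemma eval_tmap (U V W : Type) (C : structure L U) (f : V -> W) (v : W -> U) t :
  eval C v (tmap f t) = eval C (v \o f) t.
Proof. by elim: t => //= g ts IH; congr fun_interp; apply/funext. Qed.

Lemma sat_map (U V : Type) (C : structure L U) (phi : formula L V) W
    (f : V -> W) (v : W -> U) :
  sat C (formula_map phi f) v <-> sat C phi (v \o f).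
Proof.
elim: phi W f v => //=.
- by move=> V' s t W f v; rewrite !eval_tmap.
- move=> V' r ts W f v;
    rewrite (_ : (fun i => _) = fun i => eval C (v \o f) (ts i))//.
  by apply/funext => i; rewrite eval_tmap.
- by move=> V' phi IH1 psi IH2 W f v; rewrite IH1 IH2.
- move=> V' phi IH W f v; split=> h x; have := h x; rewrite IH;
    by rewrite (_ : oapp v x \o omap f = oapp (v \o f) x)//; apply/funext; case.
Qed.

Lemma tmap_comp (V W X : Type) (f : V -> W) (g : W -> X) t :
  tmap g (tmap f t) = tmap (g \o f) t.
Proof. by elim: t => //= h ts IH; congr TApp; apply/funext. Qed.

Lemma formula_map_comp (V : Type) (phi : formula L V) W X
    (f : V -> W) (g : W -> X) :
  formula_map (formula_map phi f) g = formula_map phi (g \o f).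
Proof.
elim: phi W X f g => //=.
- by move=> V' s t W X f g; rewrite !tmap_comp.
- by move=> V' r ts W X f g; congr FRel; apply/funext => i; rewrite tmap_comp.
- by move=> V' phi IH1 psi IH2 W X f g; rewrite IH1 IH2.
- by move=> V' phi IH W X f g; rewrite IH; congr (FAll (formula_map _ _));
    apply/funext; case.
Qed.

Definition FEx (V : Type) (phi : formula L (option V)) : formula L V :=
  FNot (FAll (FNot phi)).

Lemma sat_ex (U V : Type) (C : structure L U) (phi : formula L (option V)) v :
  sat C (FEx phi) v <-> exists x, sat C phi (oapp v x).
Proof.
split=> /= [h|[x hx] /(_ x)]//; apply: contrapT => n; apply: h => x hx.
by apply: n; exists x.
Qed.

Lemma term_finite_support (V : Type) (t : term L V) :
  exists (J : finType) (f : J -> V) s, t = tmap f s.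
Proof.
elim: t => [x|g ts IH]; first by exists unit, (fun=> x), (TVar L tt).
have /choice[p Hp] i : exists p : {J : finType & ((J -> V) * term L J)%type},
    ts i = tmap (tagged p).1 (tagged p).2.
  by have [J [f [s e]]] := IH i; exists (existT _ J (f, s)).
exists {i & tag (p i)}, (fun j => (tagged (p (tag j))).1 (tagged j)).
exists (TApp (fun i =>
  tmap (fun j => Tagged (fun i => tag (p i)) j) (tagged (p i)).2)) => /=.
by congr TApp; apply/funext => i; rewrite tmap_comp.
Qed.

(** This reduces formulas in arbitrarily many variables, parameters included, to the finite contexts
    in which elementarity is stated. *)
Lemma formula_finite_support (V : Type) (phi : formula L V) :
  exists (J : finType) (f : J -> V) psi, phi = formula_map psi f.
Proof.
elim: phi => {V} [V|V s t|V r ts|V phi [J [f [phi' ->]]] psi [J' [f' [psi' ->]]]|V phi [J [f [phi' ->]]]].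
- by exists void, (@of_void V), (FBot _ _).
- have [J [f [s' ->]]] := term_finite_support s.
  have [J' [f' [t' ->]]] := term_finite_support t.
  exists (J + J')%type, (fun z => match z with inl j => f j | inr j => f' j end).
  by exists (FEq (tmap inl s') (tmap inr t')); rewrite /= !tmap_comp.
- have /choice[p Hp] i : exists p : {J : finType & ((J -> V) * term L J)%type},
      ts i = tmap (tagged p).1 (tagged p).2.
    by have [J [f [s e]]] := term_finite_support (ts i); exists (existT _ J (f, s)).
  exists {i & tag (p i)}, (fun j => (tagged (p (tag j))).1 (tagged j)).
  exists (FRel (fun i =>
    tmap (fun j => Tagged (fun i => tag (p i)) j) (tagged (p i)).2)) => /=.
  by congr FRel; apply/funext => i; rewrite tmap_comp.
- exists (J + J')%type, (fun z => match z with inl j => f j | inr j => f' j end).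
  exists (FImp (formula_map phi' inl) (formula_map psi' inr)).
  by rewrite /= !formula_map_comp.
(* Only the variables that [f] sends to some [Some v] stay free; [insub] sends all others to [None],
   the bound variable. *)
- pose J' := {j : J | f j}; have Hf (j : J') : exists v, f (val j) = Some v.
    by case: j => j /=; case: (f j) => // v _; exists v.
  have /choice[f' Hf'] := Hf.
  pose g j : option J' := insub j.
  exists J', f', (FAll (formula_map phi' g)) => /=.
  rewrite formula_map_comp; congr (FAll (formula_map _ _)); apply/funext => j.
  rewrite /= /g; case: insubP => [u fu <- /=|]; first by rewrite Hf'.
  by case: (f j).
Qed.

(* The variables are moved one by one into the position of the bound variable. *)
Lemma formula_exists n (V : Type) (phi : formula L ('I_n + V)) :
  exists psi : formula L V, forall (U : Type) (C : structure L U) v,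
    sat C psi v <-> exists x : 'I_n -> U, sat C phi (sum_rect (fun=> U) x v).
Proof.
elim: n V phi => [|n IH] V phi.
  pose f (z : 'I_0 + V) : V := match z with
    | inl i => False_rect V (notF (ltn_ord i))
    | inr v => v
    end.
  exists (formula_map phi f) => U C v; rewrite sat_map.
  have E x : v \o f = sum_rect (fun=> U) x v by apply/funext => -[[]|].
  split=> [|[x]]; last by rewrite -E.
  have [u] := structure_inhabited C.
  by rewrite (E (fun=> u)); exists (fun=> u).
pose mv (z : 'I_n.+1 + V) : option ('I_n + V) :=
  match z with
  | inl i => omap inl (unlift ord0 i)
  | inr v => Some (inr v)
  end.
have [psi Hpsi] := IH _ (FEx (formula_map phi mv)).
exists psi => U C v; rewrite Hpsi; split=> [[x /sat_ex[y]]|[x h]].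
  rewrite sat_map => h; exists (fun i => oapp x y (unlift ord0 i)).
  rewrite (_ : sum_rect _ _ _ = oapp (sum_rect (fun=> U) x v) y \o mv)//.
  by apply/funext => -[i|//] /=; case: unlift.
exists (x \o lift ord0); apply/sat_ex; exists (x ord0).
rewrite sat_map (_ : _ \o _ = sum_rect (fun=> U) x v)//.
by apply/funext => -[i|//] /=; case: unliftP => [j ->|->].
Qed.

End Renaming.

(** * Countable elementary submodels *)

Section Countability.

Lemma injective_countable (T : Type) (S : countType) (f : T -> S) :
  injective f -> countable [set: T].
Proof.
move=> finj; apply: sub_countable (countableP [set: S]).
by apply: (inj_on_card_le (f := f)) => // x y _ _ /finj.
Qed.

Lemma countable_injective (T : Type) :
  countable [set: T] -> exists f : T -> nat, injective f.
Proof. by move=> /countable_injP[f finj]; exists f => x y; apply: finj;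
  rewrite inE. Qed.

Lemma countable_sigT (I : countType) (F : I -> Type) :
  (forall i, countable [set: F i]) -> countable [set: {i & F i}].
Proof.
move=> cF; have -> : [set: {i & F i}] = \bigcup_(i in [set: I]) range (existT F i).
  by apply/seteqP; split=> // -[i x] _; exists i => //; exists x.
by apply: bigcup_countable => // i _; apply: sub_countable (cF i);
    exact: card_image_le.
Qed.

Variable L : language.
Variables (cf : fun_symbol L -> nat) (cr : rel_symbol L -> nat).
Hypotheses (cf_inj : injective cf) (cr_inj : injective cr).

(** The codes are finite trees labelled by naturals, which form a countable type. *)
Fixpoint term_code (V : Type) (cv : V -> nat) (t : term L V) : GenTree.tree nat :=
  match t with
  | TVar x => GenTree.Leaf (cv x)
  | TApp f ts => GenTree.Node (cf f) [seq term_code cv (ts i) | i <- enum 'I_(fun_arity f)]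
  end.

(** Labels 0 to 3 mark the other constructors, hence the shift by 4 for relation symbols. Under a
    quantifier the bound variable gets code 0 and the others are shifted by one, so that the coding
    of variables stays injective. *)
Fixpoint formula_code (V : Type) (phi : formula L V) (cv : V -> nat) :
    GenTree.tree nat :=
  match phi with
  | FBot => GenTree.Node 0 [::]
  | FEq s t => GenTree.Node 1 [:: term_code cv s; term_code cv t]
  | FImp phi psi => GenTree.Node 2 [:: formula_code phi cv; formula_code psi cv]
  | FAll phi => GenTree.Node 3 [:: formula_code phi (oapp (S \o cv) 0)]
  | FRel r ts => GenTree.Node (cr r).+4 [seq term_code cv (ts i) | i <- enum 'I_(rel_arity r)]
  end.

Lemma term_code_inj (V : Type) (cv : V -> nat) :
  injective cv -> injective (term_code cv).
Proof.
move=> cv_inj; elim=> [x|f ts IH] [y|g us] //= []; first by move=> /cv_inj ->.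
move=> /cf_inj e; subst g => /eq_in_map e; congr TApp; apply/funext => i.
by apply: IH; apply: e; rewrite mem_enum.
Qed.

Lemma formula_code_inj (V : Type) (phi psi : formula L V) (cv : V -> nat) :
  injective cv -> formula_code phi cv = formula_code psi cv -> phi = psi.
Proof.
elim: phi psi cv => {V} [V|V s t|V r ts|V phi IH1 phi' IH2|V phi IH] [|s' t'|r' ts'|psi psi'|psi] //= cv cv_inj.
- by case=> /(term_code_inj cv_inj) -> /(term_code_inj cv_inj) ->.
- case=> /cr_inj e; subst r' => /eq_in_map e; congr FRel; apply/funext => i.
  by apply: (term_code_inj cv_inj); apply: e; rewrite mem_enum.
- by case=> /(IH1 _ _ cv_inj) -> /(IH2 _ _ cv_inj) ->.
- by case=> /IH -> // [x|] [y|] //= [] /cv_inj ->.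
Qed.

End Countability.

Lemma term_countable (L : language) (V : Type) :
  countable [set: fun_symbol L] -> countable [set: V] -> countable [set: term L V].
Proof.
move=> /countable_injective[cf cf_inj] /countable_injective[cv cv_inj].
exact: injective_countable (term_code_inj cf_inj cv_inj).
Qed.

Lemma formula_countable (L : language) (V : Type) :
  countable_language L -> countable [set: V] -> countable [set: formula L V].
Proof.
move=> [/countable_injective[cf cf_inj] /countable_injective[cr cr_inj]].
move=> /countable_injective[cv cv_inj].
apply: (injective_countable (f := fun phi => formula_code cf cr phi cv)).
by move=> phi psi /(formula_code_inj cf_inj cr_inj cv_inj).
Qed.

(** * The Tarski-Vaught test and Skolem hulls *)

Section ElementarySubmodels.
Variables (L : language) (U : Type) (C : structure L U).

Lemma tarski_vaught (M : set U) :
  (forall k (phi : formula L (option 'I_k)) (v : 'I_k -> U),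
    (forall i, M (v i)) -> (exists x, sat C phi (oapp v x)) ->
    exists2 x, M x & sat C phi (oapp v x)) ->
  elementary_submodel C M.
Proof.
move=> TV.
(* Closure under functions: the value of [f] is the only witness of the formula saying that the
   bound variable equals it. *)
have Mf (f : fun_symbol L) (xs : 'I_(fun_arity f) -> M) :
    M (fun_interp C (fun i => set_val (xs i))).
  have [||x Mx /= <-] := TV _ (FEq (TVar L None) (TApp (fun i => TVar L (Some i))))
    (fun i => set_val (xs i)); last by [].
  - by move=> i; exact: set_valP.
  - by exists (fun_interp C (fun i => set_val (xs i))).
have [m0 Mm0] : exists m, M m.
  have [u] := structure_inhabited C.
  have [||x Mx _] := TV 0 (FNot (FBot _ _)) (fun=> u); last by exists x.
    by case.
  by exists u.
pose D := @Structure L M (fun f xs => SigSub (mem_set (Mf f xs)))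
  (fun r xs => rel_interp C (fun i =>
    set_val (xs i))) (inhabits (SigSub (mem_set Mm0))).
have evD V (v : V -> M) t : set_val (eval D v t) = eval C (set_val \o v) t.
  by elim: t => //= f ts IH; congr fun_interp; apply/funext.
suff satD V (phi : formula L V) (v : V -> M) : sat D phi v <->
  sat C phi (set_val \o v).
  by exists D => n phi v; exact: satD.
elim: phi v => {V} [V|V s t|V r ts|V phi IH1 psi IH2|V phi IH] v //=.
- by rewrite -!evD; split=> [->//|]; exact: val_inj.
- rewrite (_ : (fun i => set_val _) = fun i => eval C (set_val \o v) (ts i))//.
  by apply/funext => i; rewrite evD.
- by rewrite IH1 IH2.
have ov (x : M) : set_val \o oapp v x = oapp (set_val \o v) (set_val x).
  by apply/funext; case.
split=> h x; last by rewrite IH ov; exact: h.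
apply: contrapT => n.
(* The test allows finitely many parameters only, so [phi] is first rewritten over its finite
   support, listed by ['I_#|J|]. *)
have [J [f [psi e]]] := formula_finite_support (FAll phi).
case: psi e => // psi [e].
pose w (i : 'I_#|J|) := v (f (enum_val i)).
have Ew y : oapp (set_val \o v) y \o omap f = oapp (set_val \o w) y \o omap enum_rank.
  by apply/funext => -[j|] //=; rewrite /w enum_rankK.
have Es y : sat C phi (oapp (set_val \o v) y) <->
    sat C (formula_map psi (omap enum_rank)) (oapp (set_val \o w) y).
  by rewrite e !sat_map Ew.
have [||y My] := TV _ (FNot (formula_map psi (omap enum_rank))) (set_val \o w).
- by move=> i; exact: set_valP.
- by exists x => /=; rewrite -Es.
by move=> /=; rewrite -Es; apply; have := h (SigSub (mem_set My)); rewrite IH ov.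
Qed.

Lemma elementary_sat (M : set U) : elementary_submodel C M ->
  exists D : structure L M, forall V (phi : formula L V) (v : V -> M),
    sat D phi v <-> sat C phi (set_val \o v).
Proof.
move=> [D HD]; exists D => V phi v.
have [J [f [psi ->]]] := formula_finite_support phi.
have E (W : Type) (w : V -> W) : w \o f = (w \o f \o enum_val) \o enum_rank.
  by apply/funext => j /=; rewrite enum_rankK.
rewrite !sat_map (E _ v) (E _ (set_val \o v)) -[sat D _ _]sat_map -[sat C _ _]sat_map.
exact: HD.
Qed.

(** The model is a Skolem hull. The auxiliary language [L'] has one function symbol for each formula
    with [k] parameters, interpreted by a choice of witnesses; the hull consists of the values of
    closed terms of [L'], and there are countably many of these. *)
Lemma countable_elementary_submodel :
  countable_language L -> exists2 M, countable M & elementary_submodel C M.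
Proof.
move=> cL; pose sk := {k & formula L (option 'I_k)}.
pose L' := Language (tag : sk -> nat) (fun _ : void => 0).
have /choice[w Hw] (p : {f : sk & 'I_(tag f) -> U}) : exists x,
    (exists y, sat C (tagged (tag p)) (oapp (tagged p) y)) ->
    sat C (tagged (tag p)) (oapp (tagged p) x).
  have [[y hy]|n] := EM (exists y, sat C (tagged (tag p)) (oapp (tagged p) y)).
    by exists y.
  by have [u] := structure_inhabited C; exists u.
pose C' := @Structure L' U (fun f v => w (existT _ f v)) (fun _ _ => False)
  (structure_inhabited C).
exists (range (eval C' (@of_void U))).
  apply: sub_countable (card_image_le _ _) _; apply: term_countable.
    by apply: countable_sigT => k; apply: formula_countable.
  exact: countableP.
apply: tarski_vaught => k phi v Mv [y hy].
have /choice[t Ht] i : exists t, eval C' (@of_void U) t = v i.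
  by have [t _ <-] := Mv i; exists t.
pose tt := @TApp L' void (existT _ k phi) t.
exists (eval C' (@of_void U) tt); first by exists tt.
have -> : eval C' (@of_void U) tt = w (existT _ (existT _ k phi) v).
  by congr (w (existT _ _ _)); apply/funext => i; exact: Ht.
by apply: (Hw (existT _ (existT _ k phi) v)); exists y.
Qed.

End ElementarySubmodels.

(** * Definable sets and ultrafilters *)

Lemma ultra_setC (T : Type) (F : set_system T) (A : set T) :
  UltraFilter F -> F (~` A) <-> ~ F A.
Proof.
move=> FU; split=> [FnA FA|nFA]; last by have [] := in_ultra_setVsetC A FU.
have FP : ProperFilter F := ultra_proper.
by have [x []] := filter_ex (filterI FA FnA).
Qed.

Lemma ultraP (T : Type) (F : set_system T) :
  ProperFilter F -> (forall A, F A \/ F (~` A)) -> UltraFilter F.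
Proof.
move=> FP Fd; split=> // G GP FG; apply/seteqP; split=> // A GA.
have [//|/FG GnA] := Fd A.
by have [x []] := filter_ex (filterI GA GnA).
Qed.

Lemma ultra_fmap (T T' : Type) (f : T -> T') (F : set_system T) :
  UltraFilter F -> UltraFilter (f @ F).
Proof.
by move=> FU; apply: ultraP => A; exact: (in_ultra_setVsetC (f @^-1` A)).
Qed.

Lemma ultra_of_base (T : Type) (F : set_system T) :
  F setT -> (forall A B, F A -> F B -> F (A `&` B)) ->
    (forall A, F A -> A !=set0) ->
  exists2 G : set_system T, UltraFilter G & F `<=` G.
Proof.
move=> FT FI F0.
have Hf : ProperFilter [set B | exists2 A, F A & A `<=` B].
  split; first by case=> A /F0[x Ax] /(_ _ Ax).
  split; first by exists setT.
    move=> A B [A' FA AA] [B' FB BB]; exists (A' `&` B'); first exact: FI.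
    by move=> x [/AA ? /BB].
  by move=> A B AB [A' FA AA]; exists A' => // x /AA /AB.
have [G [GU FG]] := ultraFilterLemma Hf.
by exists G => // A FA; apply: FG; exists A.
Qed.

(** This is the tensor (Fubini) product of ultrafilters. *)
Definition ultra_prod (T T' : Type) (p : set_system T) (q : set_system T') :
    set_system (T * T') :=
  [set A | p [set x | q [set y | A (x, y)]]].

Lemma ultra_prod_ultra (T T' : Type) (p : set_system T) (q : set_system T') :
  UltraFilter p -> UltraFilter q -> UltraFilter (ultra_prod p q).
Proof.
move=> pU qU; have pP : ProperFilter p by exact: ultra_proper.
have qP : ProperFilter q by exact: ultra_proper.
apply: ultraP => [|A].
  split=> [h|].
    have [x h'] := @filter_ex _ p _ _ h; by have [] := @filter_ex _ q _ _ h'.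
  split.
  - by apply: (@filterS _ p _ setT) => [x _|]; exact: filterT.
  - move=> A B pA pB.
    by apply: (@filterS2 _ p _ _ _ _ _ pA pB) => x; exact: filterI.
  - move=> A B AB.
    by apply: (@filterS _ p) => x; apply: (@filterS _ q) => y /AB.
have [|h] := in_ultra_setVsetC [set x | q [set y | A (x, y)]] pU; first by left.
right; apply: (@filterS _ p) h => x h.
exact: (proj2 (ultra_setC _ qU) h).
Qed.

Section Definable.
Variables (L : language) (U : Type) (C : structure L U).
Local Notation "x ;; c" := (sum_rect (fun=> U) x c) (at level 45).

(** Parameters are indexed by an arbitrary type [J], which makes conjunctions and changes of the
    parameter set simple; [dfn_pval] returns to formulas over [B] itself. *)
Definition definable_over (B : set U) (I : Type) (X : set (I -> U)) : Prop :=
  exists (J : Type) (phi : formula L (I + J)) (c : J -> U),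
    (forall j, B (c j)) /\ forall x, X x <-> sat C phi (x ;; c).

Lemma pvalE (I : Type) (B : set U) (x : I -> U) : pval (A := B) x = (x ;; set_val).
Proof. by apply/funext; case. Qed.

Lemma dfn_formula (B : set U) (I : Type) (phi : formula L (I + B)) :
  definable_over B [set x | sat C phi (pval x)].
Proof.
by exists B, phi, set_val; split=> [j|x /=]; [exact: set_valP|rewrite pvalE].
Qed.

Lemma dfn_pval (B : set U) (I : Type) (X : set (I -> U)) : definable_over B X ->
  exists phi : formula L (I + B), X = [set x | sat C phi (pval x)].
Proof.
move=> [J [phi [c [cB HX]]]].
pose f (z : I + J) : I + B := match z with inl i => inl i | inr j =>
  inr (SigSub (mem_set (cB j))) end.
exists (formula_map phi f); apply/seteqP; split=> x /=; rewrite HX sat_map pvalE;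
  by rewrite (_ : _ \o f = (x ;; c))//; apply/funext; case.
Qed.

Lemma dfn_sub (B B' : set U) (I : Type) (X : set (I -> U)) :
  B `<=` B' -> definable_over B X -> definable_over B' X.
Proof. by move=> BB [J [phi [c [cB HX]]]]; exists J, phi, c; split=> // j;
  exact: BB. Qed.

Lemma dfn0 (B : set U) (I : Type) (X : set (I -> U)) :
  definable0 C X -> definable_over B X.
Proof.
move=> [phi HX]; exists void, (formula_map phi inl), (@of_void U); split=> [[]|x].
by rewrite HX sat_map.
Qed.

Lemma dfnT (B : set U) (I : Type) : definable_over B [set: I -> U].
Proof. by apply: dfn0; exists (FNot (FBot _ _)) => x; split=> // _ []. Qed.

Lemma dfnC (B : set U) (I : Type) (X : set (I -> U)) :
  definable_over B X -> definable_over B (~` X).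
Proof.
move=> [J [phi [c [cB HX]]]]; exists J, (FNot phi), c; split=> // x /=.
by rewrite -HX.
Qed.

Lemma dfnI (B : set U) (I : Type) (X Y : set (I -> U)) :
  definable_over B X -> definable_over B Y -> definable_over B (X `&` Y).
Proof.
move=> [J [phi [c [cB HX]]]] [J' [psi [c' [cB' HY]]]].
pose f (z : I + J) : I + (J + J') := match z with inl i => inl i | inr j =>
  inr (inl j) end.
pose g (z : I + J') : I + (J + J') := match z with inl i => inl i | inr j =>
  inr (inr j) end.
exists (J + J')%type, (FNot (FImp (formula_map phi f) (FNot (formula_map psi g)))), (c ;; c').
split=> [[]//|x] /=; rewrite !sat_map HX HY.
have -> : (x ;; (c ;; c')) \o f = (x ;; c) by apply/funext; case.
have -> : (x ;; (c ;; c')) \o g = (x ;; c') by apply/funext; case.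
split=> [[h1 h2] /(_ h1)|h]; first exact.
by apply: contrapT => n; apply: h => h1 h2; apply: n.
Qed.

Lemma dfn_preimage (B : set U) (I I' : Type) (f : I -> I') (X : set (I -> U)) :
  definable_over B X -> definable_over B [set y : I' -> U | X (y \o f)].
Proof.
move=> [J [phi [c [cB HX]]]].
exists J, (formula_map phi (fun z => match z with inl i => inl (f i) | inr j =>
  inr j end)), c.
split=> // x /=; rewrite HX sat_map (_ : _ \o _ = ((x \o f) ;; c))//.
by apply/funext; case.
Qed.

Lemma dfn_eq (B : set U) (I : Type) (i j : I) :
    definable_over B [set x : I -> U | x i = x j].
Proof. by apply: dfn0; exists (FEq (TVar L i) (TVar L j)). Qed.

Lemma dfn_eq_param (B : set U) (I : Type) (i : I) b :
  B b -> definable_over B [set x : I -> U | x i = b].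
Proof.
by move=> Bb; exists unit, (FEq (TVar L (inl i)) (TVar L (inr tt))), (fun=> b).
Qed.

Lemma eval_aut (s : U -> U) (V : Type) (v : V -> U) t : automorphism C s ->
  eval C (s \o v) t = s (eval C v t).
Proof.
case=> _ sf _; elim: t => //= f ts IH; rewrite sf; congr fun_interp; exact/funext.
Qed.

Lemma sat_aut (s : U -> U) (V : Type) (phi : formula L V) v : automorphism C s ->
  sat C phi (s \o v) <-> sat C phi v.
Proof.
move=> sA; have [[s' sK s'K] sf sr] := sA.
elim: phi v => {V} [V|V t t'|V r ts|V phi IH1 psi IH2|V phi IH] v //=.
- by rewrite !eval_aut//; split=> [/(can_inj sK)|->].
- rewrite (_ : (fun i => _) = s \o (fun i => eval C v (ts i))) ?sr//.
  by apply/funext => i; rewrite eval_aut.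
- by rewrite IH1 IH2.
- have E x : oapp (s \o v) (s x) = s \o oapp v x by apply/funext; case.
  split=> h x; first by rewrite -IH -E.
  by rewrite -[x]s'K E IH.
Qed.

Lemma dfn_aut (s : U -> U) (B : set U) (I : Type) (X : set (I -> U)) :
  automorphism C s -> definable_over (s @` B) X ->
    definable_over B [set x | X (s \o x)].
Proof.
move=> sA [J [phi [c [cB HX]]]].
have /choice[c' Hc'] j : exists b, B b /\ s b = c j by have [b] := cB j; exists b.
exists J, phi, c'; split=> [j|x /=]; first by have [] := Hc' j.
rewrite HX; have <- : s \o (x ;; c') = ((s \o x) ;; c).
  by apply/funext => -[//|j] /=; have [] := Hc' j.
exact: sat_aut.
Qed.

Definition same_type (B : set U) (I : Type) (x y : I -> U) : Prop :=
  forall X, definable_over B X -> X x -> X y.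

Lemma same_type_refl B I (x : I -> U) : same_type B x x. Proof. by move=> X. Qed.

Lemma same_type_sym B I (x y : I -> U) : same_type B x y -> same_type B y x.
Proof.
by move=> xy X dX Xy; apply: contrapT => nX; apply: (xy _ (dfnC dX) nX).
Qed.

Lemma same_type_trans B I (x y z : I -> U) :
  same_type B x y -> same_type B y z -> same_type B x z.
Proof. by move=> xy yz X dX /(xy _ dX) /(yz _ dX). Qed.

Lemma same_type_formula (B : set U) (I : Type) (x y : I -> U) :
  same_type B x y <->
  forall phi : formula L (I + B), sat C phi (pval x) <-> sat C phi (pval y).
Proof.
split=> [xy phi|xy X /dfn_pval[phi ->] /=]; last by rewrite xy.
by split; [|move/same_type_sym : xy => xy]; exact: (xy _ (dfn_formula phi)).
Qed.

(** Existence of a solution is itself a formula over [M], by [formula_exists], and so transfers to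
    the submodel. *)
Lemma elementary_dfn_witness (M : set U) n (X : set ('I_n -> U)) :
  elementary_submodel C M -> definable_over M X -> X !=set0 ->
  exists2 x, X x & forall i, M (x i).
Proof.
move=> eM /dfn_pval[phi ->] [x0 /= hx0].
have [D HD] := elementary_sat eM; have [psi Hpsi] := formula_exists phi.
have : sat C psi (set_val \o @idfun M) by apply/Hpsi; exists x0; rewrite -pvalE.
rewrite -HD => /Hpsi[x hx].
exists (fun i => set_val (x i)) => [|i]; last exact: set_valP.
move: hx; rewrite HD /= (_ : _ \o _ = pval (fun i => set_val (x i)))//.
by apply/funext; case.
Qed.

End Definable.

(** * Saturation and homogeneity *)

Lemma filter_finite_bigcap (I T : Type) (F : set_system T) (D : set I)
    (f : I -> set T) :
  Filter F -> finite_set D -> (forall i, D i -> F (f i)) ->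
  F (\bigcap_(i in D) f i).
Proof.
move=> FF; elim/Pchoice: I => I in D f *.
move=> /finite_fsetP[X ->] h; exact: filter_bigI.
Qed.

Section Monster.
Variables (kappa : Type) (L : language) (U : Type) (C : structure L U).
Hypothesis monC : monster kappa C.

Let Hk : uncountable_strong_limit kappa. Proof. by case: monC. Qed.

(** The formulas over [B] whose solution sets are [F]-large form a complete type, finitely
    satisfiable because members of a proper filter are nonempty; saturation realizes it. This is the
    form in which compactness is used throughout. *)
Lemma realize_ultra (I : finType) (B : set U) (F : set_system (I -> U)) :
  UltraFilter F -> small kappa B ->
  exists x, forall X, definable_over C B X -> F X -> X x.
Proof.
move=> FU sB; have [_ sat_C _] := monC.
pose F' := (fun x (i : 'I_#|I|) => x (enum_val i)) @ F.
have F'U : UltraFilter F' by exact: ultra_fmap.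
have F'P : ProperFilter F' by exact: ultra_proper.
pose ph : set (formula L ('I_#|I| + B)) :=
  [set phi | F' [set y | sat C phi (pval y)]].
have phS D : finite_set D -> D `<=` ph -> exists y : 'I_#|I| -> U, forall phi,
    D phi -> sat C phi (pval y).
  move=> finD Dp.
  have : F' (\bigcap_(phi in D) [set y | sat C phi (pval y)]).
    by apply: filter_finite_bigcap.
  by move=> /filter_ex[y hy]; exists y.
have phC phi : ph phi \/ ph (FNot phi).
  exact: (in_ultra_setVsetC [set y | sat C phi (pval y)] F'U).
have [x Hx] := sat_C _ _ sB (TypeSpace phS phC).
exists (fun i => x (enum_rank i)) => X dX FX.
have [phi ephi] := dfn_pval (dfn_preimage enum_rank dX).
have /Hx : ph phi.
  rewrite /ph /= -ephi /F' /=; apply: filterS FX => y Xy /=.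
  by rewrite (_ : _ \o _ = y)//; apply/funext => i /=; rewrite enum_rankK.
by rewrite -[sat _ _ _]/([set x | sat C phi (pval x)] x) -ephi.
Qed.

Lemma homogeneous (I : finType) (B : set U) (x y : I -> U) :
  small kappa B -> same_type C B x y ->
  exists s, [/\ automorphism C s, forall b, B b -> s b = b & s \o x = y].
Proof.
move=> sB xy; have [_ _ hom_C] := monC.
(* The partial map to extend sends [x i] to [y i] and fixes everything else. It is well defined
   because equalities between coordinates of [x] are part of its type. *)
have /choice[f Hf] u : exists v, (forall i, x i = u -> v = y i) /\
    ((forall i, x i <> u) -> v = u).
  have [[i <-]|n] := EM (exists i, x i = u).
    exists (y i); split=> [j xj|/(_ i)//].
    exact/esym/(xy _ (dfn_eq C B j i) xj).
  by exists u; split=> // i xi; case: n; exists i.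
have sA : small kappa (B `|` range x).
  apply: small_setU_countable => //; apply: sub_countable (card_image_le _ _) _.
  exact: countableP.
(* Each point of the domain is named by a coordinate of [x] or by a parameter from [B]; renaming
   along [r] reduces elementarity of [f] to the equality of types. *)
have /choice[r Hr] (a : B `|` range x) : exists z : I + B,
    pval x z = set_val a /\ pval y z = f (set_val a).
  have Au : (B `|` range x) (set_val a) by exact: set_valP.
  move: (set_val a) Au => u Au.
  have [[i xi]|n] := EM (exists i, x i = u).
    by exists (inl i); split=> //=; rewrite (proj1 (Hf u) i).
  have Bu : B u by case: Au => // -[i _ xi]; case: n; exists i.
  exists (inr (SigSub (mem_set Bu))); split=> //=; rewrite (proj2 (Hf u))// => i xi.
  by apply: n; exists i.
have [|s sA' sf] := hom_C _ f sA.
  move=> phi; have /same_type_formula/(_ (formula_map phi r)) := xy.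
  rewrite !sat_map (_ : pval x \o r = set_val).
    by rewrite (_ : pval y \o r = f \o set_val)//; apply/funext => a; case: (Hr a).
  by apply/funext => a; case: (Hr a).
exists s; split=> //.
  move=> b Bb; rewrite sf ?inE; last by left.
  have [[i xi]|n] := EM (exists i, x i = b).
    rewrite (proj1 (Hf b) i xi); exact: (xy _ (dfn_eq_param C i Bb) xi).
  by apply: (proj2 (Hf b)) => i xi; apply: n; exists i.
apply/funext => i /=; rewrite sf ?inE; last by right; exists i.
by rewrite (proj1 (Hf (x i)) i).
Qed.

End Monster.

(** * Cosets and types over a model *)

Section Subgroups.
Variables (G : groupType) (H : set G).
Hypothesis sH : subgroup H.
Local Open Scope group_scope.

Lemma subgroup1 : H 1. Proof. by case: sH => /set_mem. Qed.

Lemma subgroupV x : H x -> H x^-1.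
Proof. by move=> Hx; apply/set_mem; apply: (group_closedV sH); exact/mem_set. Qed.

Lemma subgroupM x y : H x -> H y -> H (x * y).
Proof.
by move=> Hx Hy; apply/set_mem; apply: (group_closedM sH); exact/mem_set.
Qed.

Lemma subgroup_cancelr x y : H y -> H (x * y) -> H x.
Proof. by move=> /subgroupV Hy /subgroupM/(_ Hy); rewrite mulgK. Qed.

Lemma subgroup_cancell x y : H x -> H (x * y) -> H y.
Proof. by move=> /subgroupV Hx /(subgroupM Hx); rewrite mulKg. Qed.

Lemma right_cosetP a x : right_coset H a x <-> H (x * a^-1).
Proof.
split=> [[h Hh <-]|Hx]; first by rewrite mulgK.
by exists (x * a^-1) => //; rewrite mulgVK.
Qed.

Lemma coset_relP a b : coset_rel H a b <-> H (a * b^-1).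
Proof.
split=> [[c [/right_cosetP ac /right_cosetP bc]]|Hab].
  by have := subgroupM ac (subgroupV bc); rewrite invgM invgK mulgA mulgVK.
exists b; split; apply/right_cosetP => //.
by rewrite mulgV; exact: subgroup1.
Qed.

Lemma conj_subgroup k : subgroup [set g | H (k * g * k^-1)].
Proof.
split; first by rewrite inE /= mulg1 mulgV; exact: subgroup1.
move=> x y; rewrite !inE /= => Hx Hy.
by have := subgroupM Hx (subgroupV Hy); rewrite !invgM invgK !mulgA mulgVK.
Qed.

(** Left multiplication by [k^-1] maps the right cosets of [H] onto those of the conjugate. *)
Lemma conj_bounded_index kappa k :
  uncountable_strong_limit kappa -> bounded_index kappa H ->
  bounded_index kappa [set g | H (k * g * k^-1)].
Proof.
move=> Hk; apply: small_le.
apply: (image_card_le (f := fun Q => [set g | Q (k * g)])) => _ [a _ <-].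
exists (right_coset H (k * a)); first by exists (k * a).
apply/seteqP; split=> x /=.
  move=> /right_cosetP h; exists (x * a^-1); last by rewrite mulgVK.
  by move: h; rewrite /= invgM !mulgA.
by case=> g /= h <-; apply/right_cosetP; rewrite invgM !mulgA mulgK.
Qed.

End Subgroups.

Section DefinableGroup.
Variables (kappa : Type) (L : language) (U : Type) (C : structure L U).
Variables (n : nat) (G : groupType) (pt : G -> 'I_n -> U).
Hypotheses (monC : monster kappa C) (dG : definable_group C pt).
Local Open Scope group_scope.

Let Hk : uncountable_strong_limit kappa. Proof. by case: monC. Qed.

Lemma pt_inj : injective pt. Proof. by case: dG. Qed.

Lemma dfn_range B : definable_over C B (range pt).
Proof. by case: dG => _ /dfn0. Qed.

Definition triple (x y z : 'I_n -> U) : 'I_n + 'I_n + 'I_n -> U :=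
  sum_rect (fun=> U) (sum_rect (fun=> U) x y) z.

Lemma triple_eta w : w = triple (w \o inl \o inl) (w \o inl \o inr) (w \o inr).
Proof. by apply/funext => -[[]|]. Qed.

Lemma dfn_graph B :
  definable_over C B (range (fun ab : G * G =>
    triple (pt ab.1) (pt ab.2) (pt (ab.1 * ab.2)))).
Proof.
case: dG => _ _ /(dfn0 B); congr definable_over; apply/seteqP; split=> x /=.
  by case=> a [b [ea eb ec]]; exists (a, b) => //=; rewrite -ea -eb -ec -triple_eta.
by case=> [[a b]] _ <-; exists a, b.
Qed.

Lemma definable0_aut (I : Type) (X : set (I -> U)) s : automorphism C s ->
  definable0 C X -> forall x, X (s \o x) <-> X x.
Proof. by move=> sA [phi HX] x; rewrite !HX sat_aut. Qed.

(** Automorphisms preserve the 0-definable set [range pt] and the 0-definable graph of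
    multiplication. *)
Lemma group_aut s : automorphism C s -> exists t : G -> G,
  (forall a, s \o pt a = pt (t a)) /\ {morph t : a b / a * b}.
Proof.
move=> sA; case: (dG) => _ dr dm.
have /choice[t Ht] a : exists b, s \o pt a = pt b.
  have [] : range pt (s \o pt a) by apply/(definable0_aut sA dr); exists a.
  by move=> b _ <-; exists b.
exists t; split=> // a b; apply: pt_inj; rewrite -Ht.
have /(definable0_aut sA dm)[a' [b' /= [ea eb ec]]] :
  [set x : 'I_n + 'I_n + 'I_n -> U | exists a b : G,
        [/\ x \o inl \o inl = pt a, x \o inl \o inr = pt b
          & x \o inr = pt (a * b)%g]] (triple (pt a) (pt b) (pt (a * b))).
  by exists a, b.
have -> : t a = a'. by apply: pt_inj; rewrite -ea -Ht.
have -> : t b = b' by apply: pt_inj; rewrite -eb -Ht.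
by rewrite -ec.
Qed.

Definition fixes (M : set U) (s : U -> U) := forall m, M m -> s m = m.

(** Only automorphisms fixing [M] are considered: conjugates of an invariant subgroup need not be
    invariant under all automorphisms, but the coset argument below must apply to them too. *)
Definition aut_stable (M : set U) (H : set G) : Prop :=
  forall s (t : G -> G), automorphism C s -> fixes M s ->
    (forall a, s \o pt a = pt (t a)) -> forall h, H h -> H (t h).

Lemma dfn_fixes (M : set U) s (I : Type) (X : set (I -> U)) x :
  automorphism C s -> fixes M s -> definable_over C M X -> X (s \o x) <-> X x.
Proof.
move=> sA sM [J [phi [c [cM HX]]]];
  rewrite !HX -[sat C phi (sum_rect _ x c)](sat_aut _ _ sA).
rewrite (_ : s \o _ = sum_rect (fun=> U) (s \o x) c)//.
by apply/funext => -[//|j] /=; rewrite sM.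
Qed.

Lemma same_type_aut (B : set U) a b : small kappa B ->
  same_type C B (pt a) (pt b) -> exists s (t : G -> G),
  [/\ automorphism C s, fixes B s, forall a, s \o pt a = pt (t a),
      {morph t : a b / a * b} & t a = b].
Proof.
move=> sB /(homogeneous monC sB)[s [sA sfix sab]].
have [t [Ht tM]] := group_aut sA.
by exists s, t; split=> //; apply: pt_inj; rewrite -Ht.
Qed.

Lemma morphV (t : G -> G) : {morph t : a b / a * b} -> {morph t : a / a^-1}.
Proof.
move=> tM a; have t1 : t 1 = 1 by apply: (mulgI (t 1)); rewrite -tM !mulg1.
by apply: (mulgI (t a)); rewrite -tM !mulgV.
Qed.

(* Let [F] be an ultrafilter of points of [M] extending tp(a/M).  For [g]
   realizing [F] over [M] and [d], whether [Hg = Hd] depends only on tp(d/M).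
   As there are few cosets, it holds for [g] generic over representatives of all
   cosets and [d] one of them.  A further generic [e] is then in the coset of
   [g], hence also in that of every [d] of the same type as [g]. *)
Lemma same_type_coset (M : set U) (H : set G) a b :
  countable M -> elementary_submodel C M -> subgroup H -> bounded_index kappa H ->
  aut_stable M H -> same_type C M (pt a) (pt b) -> H (a * b^-1).
Proof.
move=> cM eM sH bH stH ab.
pose Mn := [set x : 'I_n -> U | forall i, M (x i)].
have [||Y [X [dX Xa XY]]|F FU HF] := @ultra_of_base _
    [set Y | exists X, [/\ definable_over C M X, X (pt a) & X `&` Mn `<=` Y]].
- by exists setT; split=> //; exact: dfnT.
- move=> Y Y' [X [dX Xa XY]] [X' [dX' Xa' XY']]; exists (X `&` X').
  by split=> //; [exact: dfnI|move=> x [[? ?] ?]; split; [exact: XY|exact: XY']].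
- have [x Xx Mx] := elementary_dfn_witness eM dX (ex_intro _ _ Xa).
  by exists x; exact: XY.
have FP : ProperFilter F by exact: ultra_proper.
have FM : F Mn by apply: HF; exists setT; split=> [||x []]//; exact: dfnT.
have Fa X : definable_over C M X -> X (pt a) -> F X.
  by move=> dX Xa; apply: HF; exists X; split=> // x [].
pose real g d := forall X, definable_over C (M `|` range (pt d)) X -> F X ->
  X (pt g).
have cpt d : countable (range (pt d)).
  by apply: sub_countable (card_image_le _ _) _; exact: countableP.
have sMd d : small kappa (M `|` range (pt d)).
  exact (small_setU_countable Hk (small_countable Hk cM) (cpt d)).
have key d d' g g' : same_type C M (pt d) (pt d') -> real g d -> real g' d' ->
    H (g * d^-1) -> H (g' * d'^-1).
  move=> dd rgd rgd' Hgd.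
  (* A first automorphism over [M] moves [d] to [d']. It fixes the points of [M], on which [F]
     concentrates, so the image of [g] realizes [F] over [M] and [d']. A second automorphism, fixing
     [d'] as well, then moves this image to [g']. *)
  have [s [t [sA sM Hs tM td]]] := same_type_aut (small_countable Hk cM) dd.
  have tgg' : same_type C (M `|` range (pt d')) (pt (t g)) (pt g').
    move=> X dX Xtg; apply: rgd' => //; have [//|FnX] := in_ultra_setVsetC X FU.
    have dY : definable_over C (M `|` range (pt d)) [set x | (~` X) (s \o x)].
      apply: dfn_aut => //; apply: dfn_sub (dfnC dX) => u [Mu|[i _ <-]].
        by exists u; [left|exact: sM].
      by exists (pt d i); [right; exists i|rewrite -td -Hs].
    have /(rgd _ dY) : F [set x | (~` X) (s \o x)].
      apply: filterS2 FnX FM => x nXx Mx /=; rewrite (_ : s \o x = x)//.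
      by apply/funext => i /=; rewrite sM.
    by rewrite /= Hs => /(_ Xtg).
  have [s' [t' [sA' sM' Hs' tM' tg']]] := same_type_aut (sMd d') tgg'.
  have td' : t' d' = d'.
    by apply: pt_inj; rewrite -Hs'; apply/funext => i /=; apply: sM'; right;
        exists i.
  have := stH _ _ sA' (fun m Mm =>
      sM' _ (or_introl Mm)) Hs' _ (stH _ _ sA sM Hs _ Hgd).
  by rewrite tM (morphV tM) td tM' (morphV tM') td' tg'.
have H1 := subgroup1 sH.
have [r Hr] : exists r : set G -> G, forall c,
    right_coset H (r (right_coset H c)) = right_coset H c.
  have /choice[r Hr] (Q : set G) : exists c, range (right_coset H) Q ->
      right_coset H c = Q.
    have [[c _ <-]|nQ] := EM (range (right_coset H) Q); first by exists c.
    by exists 1.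
  by exists r => c; apply: Hr; exists c.
(* One representative of each coset, together with [M]; bounded index keeps this set small. *)
pose B := (\bigcup_(Q in range (right_coset H)) range (pt (r Q))) `|` M.
have sB : small kappa B.
  by apply: small_setU_countable => //; apply: small_bigcup.
have [x Hx] := realize_ultra monC FU sB.
have [g _ gx] : range pt x.
  by apply: Hx; [exact: dfn_range|apply: Fa; [exact: dfn_range|exists a]].
pose c := r (right_coset H g).
have Hgc : H (g * c^-1).
  by apply/right_cosetP; rewrite /c Hr; apply/right_cosetP; rewrite // mulgV.
have rgc : real g c.
  move=> X dX FX; rewrite gx; apply: Hx => //; apply: dfn_sub dX =>
    u [|[i _ <-]]; first by right.
  by left; exists (right_coset H g); [exists g|exists i].
have [y Hy] := realize_ultra monC FU (small_setU_countable Hk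
  (small_setU_countable Hk (small_setU_countable Hk (sMd a) (cpt b)) (cpt c)) (cpt g)).
have [e _ ey] : range pt y.
  by apply: Hy; [exact: dfn_range|apply: Fa; [exact: dfn_range|exists a]].
have sub d : range (pt d) `<=` M `|` range (pt a) `|` range (pt b) `|`
    range (pt c) `|` range (pt g) -> real e d.
  move=> dP X dX FX; rewrite ey; apply: Hy => //; apply: dfn_sub dX => u.
  by case=> [Mu|/dP//]; do 4!left.
have rea : real e a by apply: sub => u; left; left; left; right.
have reb : real e b by apply: sub => u; left; left; right.
have rec : real e c by apply: sub => u; left; right.
have reg : real e g by apply: sub => u; right.
have ag : same_type C M (pt g) (pt a).
  apply: same_type_sym => X dX /(Fa _ dX); apply: rgc; apply: dfn_sub dX => u;
    by left.
have Hec : H (e * c^-1) :=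
    key _ _ _ _ (@same_type_refl _ _ C M _ (pt c)) rgc rec Hgc.
have Heg : H (e * g^-1).
  by have := subgroupM sH Hec (subgroupV sH Hgc); rewrite invgM invgK mulgA mulgVK.
have Hea := key _ _ _ _ ag reg rea Heg.
have Heb := key _ _ _ _ (same_type_trans ag ab) reg reb Heg.
by have := subgroupM sH (subgroupV sH Hea) Heb; rewrite invgM invgK mulgA mulgVK.
Qed.

End DefinableGroup.

(** * Baire category in a minimal flow of ultrafilters *)

Lemma ultra_has (T : Type) (I : eqType) (p : set_system T) (l : seq I)
    (A : I -> set T) :
  UltraFilter p -> p [set x | exists2 i, i \in l & A i x] ->
  exists2 i, i \in l & p (A i).
Proof.
move=> pU pl; apply: contrapT => n.
have pP : ProperFilter p by exact: ultra_proper.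
have : p (\bigcap_(i in [set` l]) ~` A i).
  apply: filter_finite_bigcap; first exact: finite_seq.
  by move=> i /= il; have [pA|//] := in_ultra_setVsetC (A i) pU; case: n; exists i.
by move=> /(filterI pl)/filter_ex[x [[i il Aix]] /(_ i il)].
Qed.

(** * Products and translates of ultrafilters on a group *)

Section Convolution.
Variable G : groupType.
Local Open Scope group_scope.

(* The product of the Stone-Cech compactification of [G], continuous in [p]. *)
Definition conv (p q : set_system G) : set_system G :=
  [set A | p [set g | q [set g' | A (g * g')]]].

Definition translate (h : G) (p : set_system G) : set_system G :=
  [set A | p [set g | A (h * g)]].

Lemma translateM h k p : translate h (translate k p) = translate (h * k) p.
Proof.
apply/seteqP; split=> A; rewrite /translate /=;
  by rewrite (_ : [set g | A (h * (k * g))] = [set g | A (h * k * g)])//;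
  apply/seteqP; split=> g /=; rewrite mulgA.
Qed.

Lemma translate1 p : translate 1 p = p.
Proof.
by apply/seteqP; split=> A; rewrite /translate /= (_ : [set g | A (1 * g)] = A)//;
  apply/seteqP; split=> g /=; rewrite mul1g.
Qed.

Lemma translateVK h : cancel (translate h^-1) (translate h).
Proof. by move=> p; rewrite translateM mulgV translate1. Qed.

Lemma convA p q r : conv (conv p q) r = conv p (conv q r).
Proof.
have E (A : set G) g g' : [set g'' | A (g * g' * g'')] = [set g'' | A (g * (g' * g''))].
  by apply/seteqP; split=> x /=; rewrite mulgA.
rewrite /conv; apply/funext => A /=; congr p; apply/funext => g /=; congr q.
by apply/funext => g' /=; rewrite E.
Qed.

Lemma conv_translate h p q : conv (translate h p) q = translate h (conv p q).
Proof.
rewrite /conv /translate; apply/funext => A /=; congr p; apply/funext => g /=.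
by congr q; apply/funext => g' /=; rewrite mulgA.
Qed.

Lemma conv_ultra p q :
  UltraFilter p -> UltraFilter q -> UltraFilter (conv p q).
Proof.
move=> pU qU.
exact: (@ultra_fmap _ _ (fun x : G * G => x.1 * x.2) _ (ultra_prod_ultra pU qU)).
Qed.

Lemma translate_ultra h p : UltraFilter p -> UltraFilter (translate h p).
Proof. exact: (@ultra_fmap _ _ (fun g => h * g)). Qed.

End Convolution.

Section MinimalFlow.
Variables (G : groupType) (H : set G).
Hypothesis sH : subgroup H.
Local Open Scope group_scope.

(* Filters on [G] correspond to closed sets of ultrafilters; these are the
   nonempty closed [H]-invariant sets of ultrafilters containing [H]. *)
Definition invariant_filter (Phi : set_system G) : Prop :=
  [/\ ProperFilter Phi, Phi H & forall h A, H h -> Phi A ->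
    Phi [set g | A (h * g)]].

(** A larger filter is a smaller closed set, so minimality of the flow is maximality of the
    filter. *)
Definition minimal_flow (Phi : set_system G) : Prop :=
  invariant_filter Phi /\
  forall Psi, invariant_filter Psi -> Phi `<=` Psi -> Psi `<=` Phi.

Lemma minimal_flow_exists : exists Phi, minimal_flow Phi.
Proof.
have H1 := subgroup1 sH.
have H0 : invariant_filter [set A | H `<=` A].
  split=> //; last by move=> h A Hh HA g Hg; apply: HA; exact: subgroupM.
  split; first by move=> /(_ _ H1).
  by split=> // [A B HA HB x Hx|A B AB HA x /HA /AB//]; split;
      [exact: HA|exact: HB].
have [|Phi [PPhi max]] :=
    @Zorn_bigcup _ [set Phi | Phi = set0 \/ invariant_filter Phi].
  move=> F FP Ftot.
  have [[Phi0 FPhi0 ne]|n] := EM (exists2 Phi, F Phi & invariant_filter Phi);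
      last first.
    left; apply/seteqP; split=> // A [Phi FPhi].
    by have [->//|h] := FP _ FPhi; case: n; exists Phi.
  have mem A : (\bigcup_(X in F) X) A -> exists Phi,
      [/\ F Phi, invariant_filter Phi & Phi A].
    by case=> Phi FPhi; have [->//|h PA] := FP _ FPhi; exists Phi.
  right; split; last 2 first.
  - by exists Phi0 => //; case: ne.
  - by move=> h A Hh /mem[Phi [FPhi [_ _ hh] PA]]; exists Phi => //; exact: hh.
  split; first by move=> /mem[Phi [_ [PP _ _]]]; exact: filter_not_empty.
  split.
  - by exists Phi0 => //; case: ne => ? _ _; exact: filterT.
  - move=> A B /mem[P [FP' [PP _ _] PA]] /mem[Q [FQ [QP _ _] QB]].
    have [PQ|QP'] := Ftot _ _ FP' FQ.
      by exists Q => //; apply: filterI => //; exact: PQ.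
    by exists P => //; apply: filterI => //; exact: QP'.
  - by move=> A B AB /mem[P [FP' [PP _ _] PA]]; exists P => //; exact: filterS PA.
have iPhi : invariant_filter Phi.
  case: PPhi => // e; case: (max [set A | H `<=` A]); last by right.
  by rewrite e; split=> // h; have : [set A : set G | H `<=` A] H by []; move=> /h.
exists Phi; split=> // Psi iPsi PP; apply: contrapT => n.
by apply: (max Psi); [split|right].
Qed.

Variable Phi : set_system G.
Hypothesis mPhi : minimal_flow Phi.

#[local] Instance PhiP : ProperFilter Phi. Proof. by case: mPhi => -[]. Qed.
Let PhiH : Phi H. Proof. by case: mPhi => -[]. Qed.

Definition flow (p : set_system G) : Prop := UltraFilter p /\ Phi `<=` p.

Lemma flow_nonempty : exists p, flow p.
Proof. by have [p [pU Pp]] := ultraFilterLemma PhiP; exists p. Qed.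

(** By minimality the [H]-translates of a nonempty open set cover the flow, and by compactness
    finitely many suffice. Otherwise the points avoiding all translates would form a proper nonempty
    closed invariant subset. *)
Lemma flow_cover (A : set G) p : flow p -> p A ->
  exists2 l : seq G, (forall h, h \in l -> H h) &
    Phi [set g | exists2 h, h \in l & A (h * g)].
Proof.
move=> [pU Pp] pA; apply: contrapT => n.
have [[_ _ invP] max] := mPhi.
(* The filter generated by [Phi] and the complements of the translates of [A]; it is proper exactly
   because no finite list works. *)
pose Psi : set_system G := [set B | exists l : seq G, (forall h, h \in l -> H h) /\
  exists2 P, Phi P & forall g, P g -> (forall h, h \in l -> ~ A (h * g)) -> B g].
have pP : ProperFilter p by exact: ultra_proper.
have iPsi : invariant_filter Psi.
  split; last 2 first.
  - by exists [::]; split=> //; exists H.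
  - move=> h B Hh [l [lH [P PP PB]]]; exists [seq k * h | k <- l]; split.
      by move=> _ /mapP[k /lH Hk ->]; exact: subgroupM.
    exists [set g | P (h * g)]; first exact: invP.
    move=> g Pg nA; apply: PB => // k kl; rewrite mulgA.
    by apply: nA; apply/mapP; exists k.
  split.
    move=> [l [lH [P PP PB]]]; apply: n; exists l => //; apply: filterS PP => g Pg.
    apply: contrapT => m; apply: (PB g Pg) => h hl Ah.
    by apply: m; exists h.
  split.
  - by exists [::]; split=> //; exists H.
  - move=> B B' [l [lH [P PP PB]]] [l' [lH' [P' PP' PB']]].
    exists (l ++ l'); split; first by move=> h; rewrite mem_cat => /orP[/lH|/lH'].
    exists (P `&` P'); first exact: filterI.
    move=> g [Pg Pg'] nA; split; [apply: PB|apply: PB'] => // h hl;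
      by apply: nA; rewrite mem_cat hl ?orbT.
  - move=> B B' BB [l [lH [P PP PB]]]; exists l; split=> //; exists P => // g Pg nA.
    by apply: BB; exact: PB.
have PhiPsi : Phi `<=` Psi.
  by move=> B PB; exists [::]; split=> //; exists B.
have /(max _ iPsi PhiPsi)/Pp pnA : Psi (~` A).
  exists [:: 1]; split; first by move=> h; rewrite inE => /eqP ->; exact: subgroup1.
  exists H => // g _ /(_ 1); rewrite inE eqxx mul1g; exact.
by have [x []] := filter_ex (filterI pA pnA).
Qed.

Lemma flow_translate h p : H h -> flow p -> flow (translate h p).
Proof.
move=> Hh [pU Pp]; split; first exact: translate_ultra.
by move=> A PA; apply: Pp; case: mPhi => -[_ _ inv _]; exact: inv.
Qed.

(** [conv p q] is a limit of [H]-translates of [q], and the flow is closed and invariant: it is a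
    left ideal of the closure of [H]. *)
Lemma flow_conv p q : UltraFilter p -> p H -> flow q -> flow (conv p q).
Proof.
move=> pU pH [qU Pq]; split; first exact: conv_ultra.
have pP : ProperFilter p by exact: ultra_proper.
move=> A PA; apply: filterS pH => h Hh; apply: Pq.
by case: mPhi => -[_ _ inv _]; exact: inv.
Qed.

Lemma flowH p : flow p -> p H. Proof. by move=> [_]; apply. Qed.

(** * Open, dense and comeager subsets of the flow *)

Definition flow_open (Y : set (set_system G)) : Prop :=
  forall p, flow p -> Y p -> exists2 A, p A & forall q, flow q -> q A -> Y q.

Definition flow_dense (Y : set (set_system G)) : Prop :=
  forall p A, flow p -> p A -> exists q, [/\ flow q, q A & Y q].

Definition comeager (Y : set (set_system G)) : Prop :=
  exists D : set (set (set_system G)), [/\ countable D,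
    forall O, D O -> flow_open O /\ flow_dense O &
    forall p, flow p -> (forall O, D O -> O p) -> Y p].

Lemma comeager_sub (Y Z : set (set_system G)) :
  (forall p, flow p -> Y p -> Z p) -> comeager Y -> comeager Z.
Proof.
by move=> YZ [D [cD oD DY]]; exists D; split=> // p fp /(DY p fp); exact: YZ.
Qed.

Lemma comeager_open_dense Y : flow_open Y -> flow_dense Y -> comeager Y.
Proof.
move=> oY dY; exists [set Y]; split; first exact: countable1.
  by move=> _ ->.
by move=> p _; apply.
Qed.

Lemma comeager_bigcap (I : countType) (Y : I -> set (set_system G)) :
  (forall i, comeager (Y i)) -> comeager [set p | forall i, Y i p].
Proof.
move=> /choice[D HD]; exists (\bigcup_(i in [set: I]) D i); split.
- by apply: bigcup_countable => // i _; case: (HD i).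
- by move=> O [i _ DO]; case: (HD i) => _ oD _; exact: oD.
- move=> p fp DO i; case: (HD i) => _ _; apply => // O DiO.
  by apply: DO; exists i.
Qed.

Lemma comeagerI Y Z : comeager Y -> comeager Z -> comeager (Y `&` Z).
Proof.
move=> cY cZ; have := @comeager_bigcap bool (fun b => if b then Y else Z).
move=> h; apply: comeager_sub (h _) => [p _ h'|[]//].
by split; [exact: (h' true)|exact: (h' false)].
Qed.

(** The usual proof for compact spaces: decreasing nonempty basic open sets [A n] enter the dense
    open sets one after the other, and an ultrafilter extending [Phi] contains all the [A n]. *)
Lemma baire Y : comeager Y -> exists2 p, flow p & Y p.
Proof.
move=> [D [/countable_injP[f finj] oD DY]].
(* [O n] is the member of [D] with code [n], or the whole space if there is none. *)
have /choice[O HO] (n : nat) : exists O, [/\ flow_open O, flow_dense O &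
    forall Z, D Z -> f Z = n -> Z = O].
  have [[Z DZ <-]|m] := EM (exists2 Z, D Z & f Z = n).
    exists Z; have [oZ dZ] := oD _ DZ; split=> // Z' DZ' e.
    by apply: finj; rewrite ?inE.
  exists setT; split=> //.
  - move=> p [pU _] _; exists setT => //.
    by have pP : ProperFilter p := ultra_proper; exact: filterT.
  - by move=> p A fp pA; exists p.
  - by move=> Z DZ e; case: m; exists Z.
pose pos A := exists2 p, flow p & p A.
have /choice[next Hnext] (nA : nat * set G) : exists A', pos nA.2 ->
    [/\ pos A', A' `<=` nA.2 & forall p, flow p -> p A' -> O nA.1 p].
  have [[p fp pA]|m] := EM (pos nA.2); last by exists setT.
  have [oO dO _] := HO nA.1; have [q [fq qA Oq]] := dO _ _ fp pA.
  have [B qB HB] := oO _ fq Oq; exists (nA.2 `&` B) => _.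
  have qP : ProperFilter q by case: fq => ? _; exact: ultra_proper.
  split; first by exists q => //; exact: filterI.
    by move=> x [].
  move=> r fr; have rP : ProperFilter r by case: fr => ? _; exact: ultra_proper.
  by move=> /(filterS (@subIsetr _ _ _)); exact: HB.
pose A := fix A n := if n is m.+1 then next (m, A m) else setT.
have posA n : pos (A n).
  elim: n => [|n /= IH]; last by have [] := Hnext (n, A n) IH.
  have [p fp] := flow_nonempty; exists p => //.
  by case: fp => pU _; have pP : ProperFilter p := ultra_proper; exact: filterT.
have decA m n : (m <= n)%N -> A n `<=` A m.
  elim: n => [|n IH]; first by rewrite leqn0 => /eqP ->.
  rewrite leq_eqVlt => /orP[/eqP -> //|/IH h].
  by apply: subset_trans h; have [] := Hnext (n, A n) (posA n).
have [||B [n [P PP PB]]|p pU Hp] := @ultra_of_base _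
  [set B | exists n, exists2 P, Phi P & P `&` A n `<=` B].
- by exists 0, setT => //; exact: filterT.
- move=> B B' [n [P PP PB]] [n' [P' PP' PB']]; exists (maxn n n'), (P `&` P').
    exact: filterI.
  move=> x [[Px P'x] Ax]; split; [apply: PB|apply: PB']; split=> //;
    by apply: decA Ax; rewrite ?leq_maxl ?leq_maxr.
- have [q [qU Pq] qA] := posA n; have qP : ProperFilter q by exact: ultra_proper.
  have [x hx] := filter_ex (filterI (Pq _ PP) qA).
  by exists x; exact: PB.
have fp : flow p by split=> // B PB; apply: Hp; exists 0, B => // x [].
exists p => //; apply: DY => // Z DZ.
have [_ _ /(_ Z DZ erefl) ->] := HO (f Z).
have [_ _] := Hnext (f Z, A (f Z)) (posA _); apply=> //.
(* The set [A n.+1], not [A n], is the one chosen inside [O n]. *)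
apply: Hp; exists (f Z).+1, setT; first exact: filterT.
by move=> x [].
Qed.

Lemma flow_openI Y Z : flow_open Y -> flow_open Z -> flow_open (Y `&` Z).
Proof.
move=> oY oZ p fp [Yp Zp]; have pP : ProperFilter p by case: fp => ? _;
  exact: ultra_proper.
have [A pA HA] := oY _ fp Yp; have [B pB HB] := oZ _ fp Zp.
exists (A `&` B); first exact: filterI.
move=> q fq qAB; have qP : ProperFilter q by case: fq => ? _; exact: ultra_proper.
by split; [apply: HA|apply: HB] => //; apply: filterS qAB => x [].
Qed.

Lemma flow_denseI Y Z : flow_open Y -> flow_dense Y -> flow_dense Z ->
  flow_dense (Y `&` Z).
Proof.
move=> oY dY dZ p A fp pA; have [q [fq qA Yq]] := dY _ _ fp pA.
have qP : ProperFilter q by case: fq => ? _; exact: ultra_proper.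
have [B qB HB] := oY _ fq Yq.
have [r [fr rAB Zr]] := dZ _ _ fq (filterI qA qB).
have rP : ProperFilter r by case: fr => ? _; exact: ultra_proper.
exists r; split=> //; first by apply: filterS rAB => x [].
by split=> //; apply: HB => //; apply: filterS rAB => x [].
Qed.

Lemma flow_open_translate h Y : H h ->
  flow_open Y -> flow_open [set p | Y (translate h p)].
Proof.
move=> Hh oY p fp Yp; have [A pA HA] := oY _ (flow_translate Hh fp) Yp.
exists [set g | A (h * g)] => // q fq qA.
by apply: HA => //; exact: flow_translate.
Qed.

Lemma flow_dense_translate h Y : H h ->
  flow_dense Y -> flow_dense [set p | Y (translate h p)].
Proof.
move=> Hh dY p A fp pA.
have [|q [fq qA Yq]] := dY _ [set g | A (h^-1 * g)] (flow_translate Hh fp).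
  rewrite /translate /= (_ : [set g | _] = A)//.
  by apply/seteqP; split=> g /=; rewrite mulKg.
exists (translate h^-1 q); split; first by apply: flow_translate => //;
  exact: subgroupV.
  exact: qA.
by rewrite /= translateVK.
Qed.

Lemma comeager_translate h Y : H h ->
  comeager Y -> comeager [set p | Y (translate h p)].
Proof.
move=> Hh [D [cD oD DY]].
exists [set [set p | O (translate h p)] | O in D]; split.
- exact: sub_countable (card_image_le _ _) cD.
- move=> _ [O DO <-]; have [oO dO] := oD _ DO.
  by split; [exact: flow_open_translate|exact: flow_dense_translate].
- move=> p fp h'; apply: DY; first exact: flow_translate.
  by move=> O DO; apply: (h' [set p | O (translate h p)]); exists O.
Qed.

(** Right multiplication [p |-> conv p s] is continuous: the condition that [conv p s] contains [A]
    says that [p] contains a set depending only on [A] and [s]. *)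
Lemma flow_open_conv s Y : flow s -> flow_open Y ->
    flow_open [set p | Y (conv p s)].
Proof.
move=> fs oY p fp Yp; have [pU _] := fp.
have [A pA HA] := oY _ (flow_conv pU (flowH fp) fs) Yp.
exists [set g | s [set g' | A (g * g')]] => // q fq qA.
by apply: HA => //; apply: flow_conv => //; [case: fq|exact: flowH].
Qed.

(* Every point of the flow enters [A] after translation by one of finitely many
   [h].  [W] is the open dense set of points whose translates by all these [h]
   are in [Y]; as orbits are dense, some translate of [conv p s] is in [W]. *)
Lemma flow_dense_conv s Y : flow s -> flow_open Y -> flow_dense Y ->
  flow_dense [set p | Y (conv p s)].
Proof.
move=> fs oY dY p A fp pA; have [pU _] := fp.
have [l lH Pl] := flow_cover fp pA.
pose W := [set q | forall h, h \in l -> Y (translate h q)].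
have [oW dW] : flow_open W /\ flow_dense W.
  rewrite /W; elim: l lH {Pl W} => [|h l IH] lH.
    split; last by move=> q B fq qB; exists q.
    move=> q [qU _] _; exists setT => //.
    by have qP : ProperFilter q := ultra_proper; exact: filterT.
  have [|oW dW] := IH; first by move=> k kl; apply: lH; rewrite inE kl orbT.
  have Hh : H h by apply: lH; rewrite inE eqxx.
  have -> : [set q | forall k, k \in h :: l -> Y (translate k q)] =
    [set q | Y (translate h q)] `&` [set q | forall k, k \in l ->
      Y (translate k q)].
    apply/seteqP; split=> q /=.
      by move=> h'; split=> [|k kl]; apply: h'; rewrite inE ?eqxx ?kl ?orbT.
    by move=> [h1 h2] k; rewrite inE => /orP[/eqP ->|/h2].
  split; first by apply: flow_openI => //; exact: flow_open_translate.
  by apply: flow_denseI => //;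
      [exact: flow_open_translate|exact: flow_dense_translate].
have pT : p setT by have pP : ProperFilter p := ultra_proper; exact: filterT.
have [y [fy _ Wy]] := dW _ _ fp pT.
have [B yB HB] := oW _ fy Wy.
have [l2 l2H Pl2] := flow_cover fy yB.
have fz := flow_conv pU (flowH fp) fs.
have [k kl2 zB] := ultra_has fz.1 (fz.2 _ Pl2).
have fkz := flow_translate (l2H _ kl2) fz.
have fkp := flow_translate (l2H _ kl2) fp.
have [h hl xA] := ultra_has fkp.1 (fkp.2 _ Pl).
exists (translate h (translate k p)); split=> //.
  by apply: flow_translate => //; exact: lH.
rewrite /= !conv_translate; exact: HB.
Qed.

Lemma comeager_conv s Y : flow s -> comeager Y -> comeager [set p | Y (conv p s)].
Proof.
move=> fs [D [cD oD DY]].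
exists [set [set p | O (conv p s)] | O in D]; split.
- exact: sub_countable (card_image_le _ _) cD.
- move=> _ [O DO <-]; have [oO dO] := oD _ DO.
  by split; [exact: flow_open_conv|exact: flow_dense_conv].
- move=> p fp h'; apply: DY.
    by apply: flow_conv => //; [case: fp|exact: flowH].
  by move=> O DO; apply: (h' [set p | O (conv p s)]); exists O.
Qed.

(** * The Baire property and a zero-one law *)

Definition baire_property (Y : set (set_system G)) : Prop :=
  exists2 O, flow_open O & comeager [set p | O p <-> Y p].

Lemma baire_property_open Y : flow_open Y -> baire_property Y.
Proof.
move=> oY; exists Y => //; exists set0; split=> //.
Qed.

(** If [Y] agrees generically with the open set [O], its complement agrees with the exterior [O'] of
    [O], because the union of [O] and [O'] is open and dense. *)
Lemma baire_propertyC Y : baire_property Y -> baire_property (~` Y).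
Proof.
move=> [O oO cO].
pose O' := [set p | exists2 A, p A & forall q, flow q -> q A -> ~ O q].
have oO' : flow_open O'.
  by move=> p fp [A pA HA]; exists A => // q fq qA; exists A.
have cOO' : comeager (O `|` O').
  apply: comeager_open_dense.
    move=> p fp [/(oO _ fp)|/(oO' _ fp)] [A pA HA]; exists A => // q fq qA.
      by left; exact: HA.
    by right; exact: HA.
  move=> p A fp pA; have [[q [fq qA Oq]]|n] :=
    EM (exists q, [/\ flow q, q A & O q]).
    by exists q; split=> //; left.
  by exists p; split=> //; right; exists A => // q fq qA Oq; apply: n; exists q.
exists O' => //; apply: comeager_sub (comeagerI cO cOO') => p fp [/= OY OO'].
split=> [[A pA HA] /OY|nY]; first exact: HA.
by case: OO' => // /OY.
Qed.

Lemma baire_property_bigcup (Y : nat -> set (set_system G)) :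
  (forall i, baire_property (Y i)) -> baire_property (\bigcup_i Y i).
Proof.
move=> hY; have /choice[O HO] i : exists O, flow_open O /\
  comeager [set p | O p <-> Y i p].
  by have [O] := hY i; exists O.
exists (\bigcup_i O i).
  move=> p fp [i _ Oip]; have [oi _] := HO i; have [A pA HA] := oi _ fp Oip.
  by exists A => // q fq qA; exists i => //; exact: HA.
apply: comeager_sub (comeager_bigcap (fun i => (HO i).2)) => p fp /= h.
by split=> -[i _ /h]; exists i.
Qed.

(** If [Y] agrees generically with an open set [O], either [O] misses the flow and [Y] is meager, or
    finitely many translates cover the flow. In the second case a generic point has some translate
    in [O], hence in [Y], and invariance puts the point itself in [Y]. *)
Lemma zero_one Y : baire_property Y ->
  (forall h p, H h -> flow p -> Y (translate h p) -> Y p) ->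
  comeager Y \/ comeager (~` Y).
Proof.
move=> [O oO cO] inv.
have [[p fp Op]|n] := EM (exists2 p, flow p & O p); last first.
  right; apply: comeager_sub cO => p fp /= OY Yp.
  by apply: n; exists p => //; apply/OY.
left; have [A pA HA] := oO _ fp Op; have [l lH Pl] := flow_cover fp pA.
have cW : comeager [set q | forall i : 'I_(size l),
    O (translate (tnth (in_tuple l) i) q) <->
      Y (translate (tnth (in_tuple l) i) q)].
  apply: comeager_bigcap => i; apply: (comeager_translate _ cO).
  by apply: lH; exact: mem_tnth.
apply: comeager_sub cW => q fq /= Wq.
have [h hl qA] := ultra_has fq.1 (fq.2 _ Pl).
have Hh := lH _ hl.
have /tnthP[i hi] : h \in in_tuple l by [].
apply: (inv h) => //; rewrite hi; apply/Wq; rewrite -hi.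
by apply: HA => //; exact: flow_translate.
Qed.

End MinimalFlow.

(** * Smooth implies type-definable *)

Lemma open_type_space (L : language) (U : Type) (C : structure L U) n (A : set U)
    (O : set (type_space C n A)) p :
  open O -> O p -> exists2 F : set (formula L ('I_n + A)),
    finite_set F & F `<=` p /\
    forall q : type_space C n A, F `<=` q -> O q.
Proof.
case=> D HD <- [V DV Vp]; have [E0 HE VE] := HD _ DV.
pose E : {fset set (type_space C n A)} := E0.
have /choice[c Hc] (W : set (type_space C n A)) : exists phi,
    [set` E] W -> [set q : type_space C n A | q phi] = W.
  have [WE|nW] := EM ([set` E] W); last by exists (FBot _ _).
  by have := HE _ WE; rewrite inE => -[phi _ <-]; exists phi.
have EV q : (forall W, [set` E] W -> W q) -> V q by rewrite -VE.
exists (c @` [set` E]); first by apply: finite_image; exact: finite_fset.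
split=> [_ [W EW <-]|q Fq].
  have : W p by move: Vp; rewrite -VE; apply.
  by rewrite -{1}(Hc _ EW).
exists V => //; apply: EV => W EW; rewrite -(Hc _ EW) /=.
by apply: Fq; exists W.
Qed.

Lemma cantor_coordinate_open j b : open [set z : cantor_space | z j = b].
Proof.
have -> : [set z : cantor_space | z j = b] = proj j @^-1` [set b] by [].
apply: open_comp; last exact: discrete_open.
by move=> z _; exact: proj_continuous.
Qed.

Section SmoothToTypeDefinable.
Variables (kappa : Type) (L : language) (U : Type) (C : structure L U).
Variables (n : nat) (G : groupType) (pt : G -> 'I_n -> U) (H : set G) (M : set U).
Hypotheses (monC : monster kappa C) (dG : definable_group C pt).
Hypotheses (sH : subgroup H) (iH : aut_invariant C (pt @` H)).
Hypothesis bH : bounded_index kappa H.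
Hypotheses (cM : countable M) (eM : elementary_submodel C M).
Local Open Scope group_scope.

Let Hk : uncountable_strong_limit kappa. Proof. by case: monC. Qed.

Lemma aut_invariant_stable : aut_stable C pt M H.
Proof.
move=> s t sA _ Ht h Hh; have [|h' Hh' e] := (iH sA (pt h)).2; first by exists h.
by move: e; rewrite Ht => /(pt_inj dG) <-.
Qed.

Lemma aut_invariant_coset a b : same_type C M (pt a) (pt b) -> H (a * b^-1).
Proof. exact: (same_type_coset monC dG cM eM sH bH aut_invariant_stable). Qed.

(** The conjugate of [H] by [k] is stable under automorphisms over [M]: these move [k] only within
    its coset of [H], so they preserve the conjugate. *)
Lemma aut_invariant_conj_coset k a b : same_type C M (pt a) (pt b) ->
  H (k * (a * b^-1) * k^-1).
Proof.
rewrite -[H _]/([set g | H (k * g * k^-1)] (a * b^-1)).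
apply: (same_type_coset monC dG cM eM (conj_subgroup sH k) (conj_bounded_index k Hk bH)).
move=> s t sA sM Ht h /= Hh.
have tM : {morph t : x y / x * y}.
  have [t' [Ht' tM]] := group_aut dG sA.
  by suff -> : t = t' by []; apply/funext => x; apply: (pt_inj dG);
      rewrite -Ht -Ht'.
have tk : H (t k * k^-1).
  apply: aut_invariant_coset => X dX; rewrite -Ht => Xsk.
  by apply/(dfn_fixes _ sA sM dX).
have := aut_invariant_stable sA sM Ht Hh; rewrite !tM (morphV tM) => h1.
have := subgroupM sH (subgroupM sH (subgroupV sH tk) h1) tk.
by rewrite invgM invgK !mulgA !mulgVK.
Qed.

Definition limit_type (p : set_system G) (a : G) : Prop :=
  forall X, definable_over C M X -> p [set g | X (pt g)] -> X (pt a).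

Lemma limit_type_same p a b : UltraFilter p ->
  limit_type p a -> limit_type p b -> same_type C M (pt a) (pt b).
Proof.
move=> pU pa pb X dX Xa; apply: pb => //.
have [//|pnX] := in_ultra_setVsetC [set g | X (pt g)] pU.
by case: (pa _ (dfnC dX) pnX).
Qed.

(** Realizing the product ultrafilter gives [k] and [l] with limit types those of [p] and [q], such
    that [k * l] has that of [conv p q]. Replacing [k] by [a] and [k * l] by [c] stays within cosets
    of [H]; replacing the right factor [l] by [b] needs the conjugate version with [k]. *)
Lemma limit_type_conv p q a b c : UltraFilter p -> UltraFilter q ->
  limit_type p a -> limit_type q b -> limit_type (conv p q) c ->
  H (c * (a * b)^-1).
Proof.
move=> pU qU pa qb pqc.
have pP : ProperFilter p by exact: ultra_proper.
have qP : ProperFilter q by exact: ultra_proper.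
have pqU : UltraFilter (ultra_prod p q) by exact: ultra_prod_ultra.
pose f (ab : G * G) := triple (pt ab.1) (pt ab.2) (pt (ab.1 * ab.2)).
have fU : UltraFilter (f @ ultra_prod p q) by exact: ultra_fmap.
have [x Hx] := realize_ultra monC fU (small_countable Hk cM).
have [[k l] _ xE] : range f x.
  apply: Hx; first exact: dfn_graph.
  rewrite /= /ultra_prod /=; apply: (@filterS _ p _ setT) => [g _|];
    last exact: filterT.
  apply: (@filterS _ q _ setT) => [g' _ /=|]; last exact: filterT.
  by exists (g, g').
have pk : limit_type p k.
  move=> X dX pX; have := Hx _ (dfn_preimage (inl \o inl) dX).
  rewrite -xE; apply; rewrite /= /ultra_prod /=; apply: filterS pX => g Xg.
  by apply: (@filterS _ q _ setT); [move=> g' _|exact: filterT].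
have ql : limit_type q l.
  move=> X dX qX; have := Hx _ (dfn_preimage (inl \o inr) dX).
  rewrite -xE; apply; rewrite /= /ultra_prod /=.
  by apply: (@filterS _ p _ setT) => [g _|]; [exact: filterS qX|exact: filterT].
have pqkl : limit_type (conv p q) (k * l).
  by move=> X dX pqX; have := Hx _ (dfn_preimage inr dX); rewrite -xE; apply.
have h1 := aut_invariant_coset (limit_type_same (conv_ultra pU qU) pqc pqkl).
have h2 := aut_invariant_coset (limit_type_same pU pk pa).
have h3 := aut_invariant_conj_coset k (limit_type_same qU ql qb).
have := subgroupM sH h1 (subgroupM sH h3 h2).
by rewrite !invgM !mulgA !mulgVK.
Qed.

Variable K : set G.
Hypotheses (sK : subgroup K) (tK : type_definable kappa C (pt @` K)) (HK :
  H `<=` K).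

(** The limit is realized over the parameters defining [K] as well as over [M]; as [p] concentrates
    on [H], hence on [K], the realization satisfies all formulas defining [K]. *)
Lemma limit_type_exists p : UltraFilter p -> p H -> exists2 a, K a & limit_type p a.
Proof.
move=> pU pH; have pP : ProperFilter p by exact: ultra_proper.
have [A [P [sA HP]]] := tK.
have fU : UltraFilter (pt @ p) by exact: ultra_fmap.
have [x Hx] := realize_ultra monC fU (small_setU_countable Hk sA cM).
have [a Ka ax] : (pt @` K) x.
  apply/HP => phi Pphi; apply: (Hx [set x | sat C phi (pval x)]).
    by apply: dfn_sub (dfn_formula C phi) => u; left.
  rewrite /=; apply: filterS pH => h /HK Kh /=.
  by apply: (HP (pt h)).1 => //; exists h.
exists a => // X dX pX; rewrite ax; apply: Hx => //.
by apply: dfn_sub dX => u; right.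
Qed.

Lemma tp_formula_same (x y : 'I_n -> U) :
  realizes x (tp C M y) <-> same_type C M y x.
Proof.
split=> [h X /dfn_pval[phi ->]|h phi]; first exact: h.
exact: (h _ (dfn_formula C phi)).
Qed.

(** All realizations of a type over [M] lie in one coset, so the choice of realizations is
    immaterial. *)
Lemma coset_rel_types_tp a b :
    coset_rel_types pt H (tp C M (pt a)) (tp C M (pt b)) <->
  H (a * b^-1).
Proof.
split=> [[a' [b' [/tp_formula_same aa' /tp_formula_same bb' /(coset_relP sH) h]]]|h].
  have ha := aut_invariant_coset aa'; have hb :=
      aut_invariant_coset (same_type_sym bb').
  by have := subgroupM sH (subgroupM sH ha h) hb; rewrite !mulgA !mulgVK.
by exists a, b; split; [apply/tp_formula_same..|apply/(coset_relP sH)].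
Qed.

Let TK := types_of C M (pt @` K).

Theorem smooth_type_definable :
  smooth (fun p q : TK => coset_rel_types pt H (set_val p) (set_val q)) ->
  type_definable kappa C (pt @` H).
Proof.
move=> [g [gB gE]].
(* [r p] is a point of [K] realizing the limit type of [p]; the value 1 is a default for families
   that are not ultrafilters containing [H]. *)
have /choice[r Hr] (p : set_system G) : exists a, K a /\
    (UltraFilter p -> p H -> limit_type p a).
  have [[pU pH]|np] := EM (UltraFilter p /\ p H).
    by have [a Ka pa] := limit_type_exists pU pH; exists a.
  by exists 1; split=> [|pU pH]; [exact: subgroup1|case: np].
have rK p : TK (tp C M (pt (r p))) by exists (pt (r p)) => //; exists (r p) =>
    //; case: (Hr p).
have rT p : UltraFilter p -> p H -> limit_type p (r p) by case: (Hr p).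
pose t p : TK := SigSub (mem_set (rK p)).
have gt p q : g (t p) = g (t q) <-> H (r p * (r q)^-1).
  by rewrite -coset_rel_types_tp; split; [move=> /gE|move=> h; apply/gE].
have rconv p q : UltraFilter p -> UltraFilter q -> p H -> q H ->
    H (r (conv p q) * (r p * r q)^-1).
  move=> pU qU pH qH; have pqU := conv_ultra pU qU.
  apply: (limit_type_conv pU qU); [exact: rT|exact: rT|apply: rT => //].
  have pP : ProperFilter p by exact: ultra_proper.
  have qP : ProperFilter q by exact: ultra_proper.
  apply: (@filterS _ p) pH => h Hh; apply: (@filterS _ q) qH => h' Hh'.
  exact: subgroupM.
have [Phi mPhi] := minimal_flow_exists sH.
have rphi p phi : UltraFilter p -> p H ->
    sat C phi (pval (pt (r p))) <-> p [set g | sat C phi (pval (A := M) (pt g))].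
  move=> pU pH; split=> h; last exact: (rT _ pU pH _ (dfn_formula C phi) h).
  have [//|pn] := in_ultra_setVsetC [set g | sat C phi (pval (A := M) (pt g))] pU.
  by case: (rT _ pU pH _ (dfnC (dfn_formula C phi)) pn).
(* By [rphi] the map [t] is continuous on the flow, and the sets with the Baire property form a
   sigma-algebra containing the preimages of open sets. *)
have BP (B : set TK) : borel B -> baire_property Phi [set p | B (t p)].
  move: B; apply: smallest_sub.
    split.
    - by apply: baire_property_open => p _ [].
    - move=> B BB; rewrite (_ : [set p | _] = ~` [set p | B (t p)]).
        exact: baire_propertyC.
      by apply/seteqP; split=> p /=; rewrite /setD /=; tauto.
    - move=> F BF; rewrite (_ : [set p | _] = \bigcup_i [set p | F i (t p)]).
        exact: baire_property_bigcup.
      by apply/seteqP; split=> p [i _ Fi]; exists i.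
  move=> B [O oO <-]; apply: baire_property_open => p [pU Pp] /= Op.
  have pH : p H by exact: (flowH mPhi).
  have [F finF [FO OF]] := open_type_space oO Op.
  exists (\bigcap_(phi in F) [set g | sat C phi (pval (A := M) (pt g))]).
    by apply: filter_finite_bigcap => // phi /FO Fphi; apply/rphi.
  move=> q fq qF; apply: OF => phi Fphi; apply/rphi;
    [by case: fq|exact: (flowH mPhi)|].
  have [qU _] := fq; have qP : ProperFilter q := ultra_proper.
  by apply: filterS qF => x; apply.
(* The zero-one law is applied to each bit of [g \o t] separately; countably many bits then make
   [g \o t] generically equal to a single [z]. *)
have cls j : exists b : bool, comeager Phi [set p | g (t p) j = b].
  have bY : baire_property Phi [set p | g (t p) j = true].
    apply: (BP [set x | g x j = true]);
      apply: (gB [set z : cantor_space | z j = true]).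
    apply: sub_sigma_algebra; exact: cantor_coordinate_open.
  have [|h|h] := zero_one sH mPhi bY; last 2 first.
  - by exists true.
  - by exists false; apply: comeager_sub h => p _ /=; case: (g _ _).
  move=> h p Hh fp /=; have [pU pH] : UltraFilter p /\ p H by split;
    [case: fp|exact: (flowH mPhi)].
  have fhp := flow_translate mPhi Hh fp.
  have [hpU hpH] : UltraFilter (translate h p) /\ (translate h p) H
    by split; [case: fhp|exact: (flowH mPhi)].
  suff -> : g (t (translate h p)) = g (t p) by [].
  (* Translation by [h] is multiplication by the principal ultrafilter at [h], so [r] of the
     translate lies in [H h (r p)], which is [H (r p)]. *)
  have conv_h : conv (principal_filter h) p = translate h p.
    by apply/funext => A; apply/propext; exact: principal_filterP.
  have hh : limit_type (principal_filter h) h.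
    by move=> X _ /principal_filterP.
  apply/gt; have := limit_type_conv (principal_filter_ultra h) pU hh (rT _ pU pH).
  rewrite conv_h => /(_ _ (rT _ hpU hpH)); rewrite invgM mulgA.
  exact: (subgroup_cancelr sH (subgroupV sH Hh)).
have {cls}/choice[z Hz] := cls.
have cY : comeager Phi [set p | g (t p) = z].
  apply: comeager_sub (comeager_bigcap Hz) => p _ h; exact/funext.
have [r0 fr0] := flow_nonempty mPhi.
have [r0U _] := fr0; have r0H := flowH mPhi fr0.
have [p0 fp0 z0] := baire mPhi cY; pose k := r p0.
have [p0U _] := fp0; have p0H := flowH mPhi fp0.
have Hkq q : UltraFilter q -> q H -> H (k * r q * k^-1).
  (* Here [q] need not be in the flow, but [conv q r0] is. A generic [x] is chosen such that [x],
     [conv x r0] and [conv x (conv q r0)] all have limits in the coset [Hk]. *)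
  move=> qU qH; have fs := flow_conv mPhi qU qH fr0.
  have cI := comeagerI (comeagerI cY (comeager_conv sH mPhi fr0 cY)) (comeager_conv sH mPhi fs cY).
  have [x fx [[/= x1 x2] x3]] := baire mPhi cI.
  have [xU _] := fx; have xH := flowH mPhi fx.
  have xqU := conv_ultra xU qU.
  have xqH : conv x q H.
    have xP : ProperFilter x := ultra_proper; have qP : ProperFilter q :=
        ultra_proper.
    apply: (@filterS _ x) xH => h Hh; apply: (@filterS _ q) qH => h' Hh'.
    exact: subgroupM.
  have h1 : H (r (conv x r0) * k^-1) by apply/gt; rewrite x2 z0.
  have h2 : H (r (conv (conv x q) r0) * k^-1) by apply/gt; rewrite convA x3 z0.
  have h3 : H (r x * k^-1) by apply/gt; rewrite x1 z0.
  have h4 := rconv _ _ xU r0U xH r0H.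
  have h5 := rconv _ _ xqU r0U xqH r0H.
  have h6 := rconv _ _ xU qU xH qH.
  have h7 : H (k * r r0 * k^-1).
    have := subgroupM sH (subgroupM sH (subgroupV sH h3) (subgroupV sH h4)) h1.
    by rewrite !invgM !invgK !mulgA !mulgVK.
  have h8 : H (k * r q * r r0 * k^-1).
    have := subgroupM sH (subgroupM sH (subgroupM sH (subgroupV sH h3) (subgroupV sH h6)) (subgroupV sH h5)) h2.
    by rewrite !invgM !invgK !mulgA !mulgVK.
  by have := subgroupM sH h8 (subgroupV sH h7);
      rewrite !invgM !invgK !mulgA !mulgVK mulgK.
(* For [q] equal to [p0], whose limit is [k] itself, the conjugate reduces to [k]. *)
have Hk0 : H k by have := Hkq _ p0U p0H; rewrite mulgK.
have main q : UltraFilter q -> q H -> H (r q).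
  move=> qU qH; apply: (subgroup_cancell sH Hk0).
  exact: (subgroup_cancelr sH (subgroupV sH Hk0) (Hkq _ qU qH)).
(* The candidate definition is the set of all formulas over [M] that hold throughout [H]. *)
exists M, [set phi | forall h, H h -> sat C phi (pval (pt h))].
split=> [|x]; first exact (small_countable Hk cM).
split=> [[h Hh <-] phi|hx]; first exact.
have hX X : definable_over C M X -> (forall h, H h -> X (pt h)) -> X x.
  by move=> /dfn_pval[phi ->]; exact: hx.
have [a _ ax] : range pt x by apply: hX; [exact: dfn_range|move=> h _; exists h].
exists a => //.
(* An ultrafilter containing [H] with limit type that of [a]: an [M]-definable set containing [a]
   meets [H], since otherwise its complement would hold on [H] and hence at [a]. *)
have [||B [X [dX Xa XB]]|q qU Hq] := @ultra_of_base _
    [set B | exists X, [/\ definable_over C M X,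
      X (pt a) & H `&` [set g | X (pt g)] `<=` B]].
- by exists setT; split=> //; exact: dfnT.
- move=> B B' [X [dX Xa XB]] [X' [dX' Xa' XB']]; exists (X `&` X').
  by split=> //; [exact: dfnI|move=> y [Hy [? ?]]; split; [exact: XB|exact: XB']].
- apply: contrapT => nB; have : (~` X) x.
    apply: hX; first exact: dfnC.
    by move=> h Hh Xh; apply: nB; exists h; exact: XB.
  by rewrite -ax.
have qH : q H by apply: Hq; exists setT; split=> [||y []]//; exact: dfnT.
have qa : limit_type q a.
  move=> X dX qX; apply: contrapT => nX.
  have qnX : q (~` [set g | X (pt g)]).
    by apply: Hq; exists (~` X); split=> [||y []]//; exact: dfnC.
  exact: (proj1 (ultra_setC _ qU) qnX).
have h := aut_invariant_coset (limit_type_same qU qa (rT _ qU qH)).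
by have := subgroupM sH h (main _ qU qH); rewrite mulgVK.
Qed.

End SmoothToTypeDefinable.

(** * Type-definable implies smooth *)

Section Borel.
Variable W : topologicalType.

Lemma borelC (B : set W) : borel B -> borel (~` B).
Proof.
move=> bB; have [_ h _] := smallest_sigma_algebra [set: W] (@open W).
rewrite (_ : ~` B = setT `\` B); first exact: h.
by apply/seteqP; split=> x /=; rewrite /setD /=; tauto.
Qed.

Lemma borel_bigcup (F : nat -> set W) : (forall i, borel (F i)) ->
    borel (\bigcup_i F i).
Proof. by have [_ _ h] := smallest_sigma_algebra [set: W] (@open W); exact: h. Qed.

Lemma borel_bigcap (F : nat -> set W) : (forall i, borel (F i)) ->
  borel [set x | forall i, F i x].
Proof.
move=> bF; have := borelC (borel_bigcup (fun i => borelC (bF i))).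
congr borel; apply/seteqP; split=> x /= h.
  by move=> i; apply: contrapT => n; apply: h; exists i.
by move=> [i _]; apply.
Qed.

Lemma borel0 : borel (set0 : set W).
Proof. by have [] := smallest_sigma_algebra [set: W] (@open W). Qed.

Lemma borel_open (O : set W) : open O -> borel O.
Proof. exact: sub_sigma_algebra. Qed.

Lemma borelT : borel (setT : set W).
Proof. exact: borel_open openT. Qed.

Lemma cantor_open_cylinder (O : set cantor_space) z : open O -> O z ->
  exists m, forall y : cantor_space, (forall i, (i < m)%N -> y i = z i) -> O y.
Proof.
move=> oO Oz.
pose F : set_system cantor_space := [set A | exists m, forall y : cantor_space,
  (forall i, (i < m)%N -> y i = z i) -> A y].
have FF : Filter F.
  split.
  - by exists 0.
  - move=> A B [m mA] [m' mB]; exists (maxn m m') => y h.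
    by split; [apply: mA|apply: mB] => i im; apply: h; rewrite leq_max im ?orbT.
  - by move=> A B AB [m mA]; exists m => y /mA /AB.
(* The cylinders around [z] generate a filter converging to [z] in each coordinate, hence in the
   product topology. *)
have Fz : F --> (z : cantor_space).
  apply/cvg_sup => i A [B [[V oV <-] Vz] BA].
  by exists i.+1 => y h; apply: BA; rewrite /= h.
by apply: Fz; exact: open_nbhs_nbhs.
Qed.

(** An open set is the union of the cylinders it contains, and these are indexed by finite bit
    strings, of which there are countably many. *)
Lemma borel_fun_cantor (g : W -> cantor_space) :
  (forall j, borel [set x | g x j = true]) -> borel_fun g.
Proof.
move=> gj; have gb j b : borel [set x | g x j = b].
  case: b => //; have := borelC (gj j); congr borel.
  by apply/seteqP; split=> x /=; case: (g x j).
apply: smallest_sub.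
  split; [exact: borel0| |].
  - move=> A bA; rewrite /=; have := borelC bA; congr borel.
    by apply/seteqP; split=> x; rewrite /preimage /setD /=; tauto.
  - by move=> F bF; rewrite /= preimage_bigcup; exact: borel_bigcup.
move=> O oO; rewrite /=.
pose cyl (s : seq bool) : set cantor_space :=
  [set y | forall i, (i < size s)%N -> y i = nth false s i].
have bc s : borel (g @^-1` cyl s).
  have := @borel_bigcap (fun i =>
      [set x | (i < size s)%N -> g x i = nth false s i]).
  apply=> i; case: (i < size s)%N.
    by have := gb i (nth false s i); congr borel; apply/seteqP; split=> x /=;
        [|apply].
  by have := borelT; congr borel; apply/seteqP; split.
pose F (m : nat) : set W := if choice.unpickle m is Some s then
  [set x | cyl s `<=` O /\ cyl s (g x)] else set0.
have -> : g @^-1` O = \bigcup_m F m.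
  apply/seteqP; split=> x.
    move=> Ox; have [m mO] := cantor_open_cylinder oO Ox.
    exists (choice.pickle (mkseq (g x) m)) => //; rewrite /F choice.pickleK; split.
      move=> y hy; apply: mO => i im.
      by have := hy i; rewrite size_mkseq => /(_ im) ->; rewrite nth_mkseq.
    by move=> i; rewrite size_mkseq => im; rewrite nth_mkseq.
  by move=> [m _]; rewrite /F; case: choice.unpickle => // s [sO /sO].
apply: borel_bigcup => m; rewrite /F; case: choice.unpickle => [s|];
  last exact: borel0.
have [sO|nO] := EM (cyl s `<=` O).
  by have := bc s; congr borel; apply/seteqP; split=> x /=; [|case].
by have := borel0; congr borel; apply/seteqP; split=> x //= [].
Qed.

End Borel.

Lemma type_formula_open (L : language) (U : Type) (C : structure L U) n (A : set U)
    (phi : formula L ('I_n + A)) : open [set p : type_space C n A | p phi].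
Proof.
pose V := [set p : type_space C n A | p phi].
exists [set V]; last by rewrite bigcup_set1.
move=> _ ->; exists [fset V]%fset.
  by move=> B /fset1P ->; rewrite inE; exists phi.
by apply/seteqP; split=> p /=; [apply; rewrite /= inE|move=> h B /= /fset1P ->].
Qed.

Section TypeDefinableToSmooth.
Variables (kappa : Type) (L : language) (U : Type) (C : structure L U).
Variables (n : nat) (G : groupType) (pt : G -> 'I_n -> U) (H K : set G).
Hypotheses (monC : monster kappa C) (dG : definable_group C pt).
Hypotheses (sH : subgroup H) (iH : aut_invariant C (pt @` H)).
Hypothesis tH : type_definable kappa C (pt @` H).
Local Open Scope group_scope.

Let Hk : uncountable_strong_limit kappa. Proof. by case: monC. Qed.

(** [P] and [Q] stand for partial types over [M]. As [H] is type-definable, lying in one coset of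
    [H] is a type-definable relation, so finite satisfiability of [P], [Q] and this relation gives a
    common realization. *)
Lemma coset_compactness (M : set U) (P Q : set (set ('I_n -> U))) : countable M ->
  P setT -> Q setT -> (forall X Y, P X -> P Y -> P (X `&` Y)) ->
  (forall X Y, Q X -> Q Y -> Q (X `&` Y)) ->
  P `<=` @definable_over _ _ C M 'I_n -> Q `<=` @definable_over _ _ C M 'I_n ->
  (forall X Y, P X -> Q Y -> exists a b, [/\ X (pt a), Y (pt b) & H (a * b^-1)]) ->
  exists a b, [/\ forall X, P X -> X (pt a), forall Y, Q Y ->
    Y (pt b) & H (a * b^-1)].
Proof.
move=> cM PT QT PI QI PD QD h.
have [||B [X [Y [PX QY XYB]]]|F FU HF] := @ultra_of_base _ [set B : set (G * G) |
    exists X Y, [/\ P X, Q Y &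
      [set ab | [/\ X (pt ab.1), Y (pt ab.2) & H (ab.1 * ab.2^-1)]] `<=` B]].
- by exists setT, setT.
- move=> B B' [X [Y [PX QY XYB]]] [X' [Y' [PX' QY' XYB']]].
  exists (X `&` X'), (Y `&` Y'); split; [exact: PI|exact: QI|].
  by move=> ab [[? ?] [? ?] ?]; split; [exact: XYB|exact: XYB'].
- have [a [b hab]] := h _ _ PX QY; by exists (a, b); exact: XYB.
have FP : ProperFilter F by exact: ultra_proper.
have [A [T [sA HT]]] := tH.
(* The first coordinate carries the membership in [H]; the third is [ab.1], written as a product so
   that the triple lies on the graph of multiplication. *)
pose f (ab : G * G) :=
  triple (pt (ab.1 * ab.2^-1)) (pt ab.2) (pt (ab.1 * ab.2^-1 * ab.2)).
have fU : UltraFilter (f @ F) by exact: ultra_fmap.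
have [x Hx] := realize_ultra monC fU (small_setU_countable Hk sA cM).
have [[k b] _ /= xE] :
    range (fun ab : G * G => triple (pt ab.1) (pt ab.2) (pt (ab.1 * ab.2))) x.
  apply: Hx; first exact: dfn_graph.
  by apply: (@filterS _ F _ setT) => [ab _|];
      [exists (ab.1 * ab.2^-1, ab.2)|exact: filterT].
exists (k * b), b; split.
- move=> X PX; have :=
    Hx _ (dfn_preimage inr (dfn_sub (@subsetUr _ A M) (PD _ PX))).
  rewrite -xE; apply; apply: HF; exists X, setT; split=> // ab [Xa _ _].
  by rewrite /= /f /preimage /= mulgVK.
- move=> Y QY; have :=
    Hx _ (dfn_preimage (inl \o inr) (dfn_sub (@subsetUr _ A M) (QD _ QY))).
  by rewrite -xE; apply; apply: HF; exists setT, Y; split=> // ab [].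
- rewrite mulgK; have [k' Hk' /(pt_inj dG) <-//] : (pt @` H) (pt k).
  apply/HT => phi Tphi.
  have := Hx _ (dfn_preimage (inl \o inl) (dfn_sub (@subsetUl _ A M) (dfn_formula C phi))).
  rewrite -xE; apply; apply: HF; exists setT, setT; split=> // ab [_ _ Hab].
  by rewrite /= /preimage /=; apply: (HT _).1 => //; exists (ab.1 * ab.2^-1).
Qed.

Theorem type_definable_smooth : countable_language L -> coset_rel_smooth C pt H K.
Proof.
move=> cL; have [M cM eM] := countable_elementary_submodel C cL.
exists M; split=> //.
set TK := types_of C M (pt @` K).
have cF : countable [set: formula L ('I_n + M)].
  apply: formula_countable => //; have [c c_inj] : exists c : M -> nat, injective c.
    have /countable_injP[c c_inj] := cM; exists (c \o set_val) => x y /c_inj.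
    by rewrite !inE => h; apply: val_inj; apply: h; exact: set_valP.
  apply: (injective_countable (f := fun z : 'I_n + M =>
    match z return ('I_n + nat)%type with inl i => inl i | inr m => inr (c m) end)).
  by move=> [i|m] [j|m'] // [] => [->//|/c_inj ->].
(* The formulas over [M] are enumerated as [psi]; numbers that code nothing get [FBot]. *)
have [code code_inj] := countable_injective cF.
have /choice[psi Hpsi] (j : nat) : exists phi, forall phi', code phi' = j ->
    phi' = phi.
  have [[phi <-]|m] := EM (exists phi, code phi = j); first by exists phi =>
      phi' /code_inj.
  by exists (FBot _ _) => phi' e; case: m; exists phi'.
have psi_code phi : psi (code phi) = phi by rewrite -(Hpsi _ phi).
(* Coordinate [j] of the reduction records whether [p] is in the saturation of the clopen set of
   [psi j]. *)
pose near (p : TK) j := exists b, realizes (pt b) (set_val p) /\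
  exists a, sat C (psi j) (pval (pt a)) /\ H (a * b^-1).
have TKP (p : TK) : exists c, set_val p = tp C M (pt c).
  by have [_ [c _ <-] e] := set_valP p; exists c.
pose g (p : TK) : cantor_space := fun j => `[< near p j >].
have stH : aut_stable C pt M H := aut_invariant_stable dG iH.
exists g; split.
  apply: borel_fun_cantor => j.
  (* The saturation is closed: its complement is the union [O] of the clopen sets of those [chi]
     that no coset of [H] links to [psi j]. That a type outside [O] is in the saturation is
     compactness. *)
  pose O := \bigcup_(chi in [set chi : formula L ('I_n + M) | forall a b,
      sat C chi (pval (pt b)) -> sat C (psi j) (pval (pt a)) -> ~ H (a * b^-1)])
    [set q : type_space C n M | q chi].
  have oO : open O by apply: bigcup_open => chi _; exact: type_formula_open.
  have : borel (~` (set_val @^-1` O : set TK)).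
    by apply: borelC; apply: borel_open; exists O.
  congr borel; apply/seteqP; split=> p /=; last first.
    move=> /asboolP[b [bp [a [ha hab]]]] [chi hchi pchi].
    exact: (hchi a b (bp _ pchi) ha).
  move=> nO; apply/asboolP; have [c pc] := TKP p.
  have [||||||||a [b [ha hb hab]]] := @coset_compactness M
    [set X | definable_over C M X /\ [set x | sat C (psi j) (pval x)] `<=` X]
    [set Y | definable_over C M Y /\ Y (pt c)] => //.
  - by split=> //; exact: dfnT.
  - by split=> //; exact: dfnT.
  - move=> X Y [dX sX] [dY sY]; split; first exact: dfnI.
    by move=> x hx; split; [exact: sX|exact: sY].
  - by move=> X Y [dX Xc] [dY Yc]; split; first exact: dfnI.
  - by move=> X [].
  - by move=> X [].
  - move=> X Y [dX sX] [/dfn_pval[chi ->] Yc]; apply: contrapT => m; apply: nO.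
    exists chi; last by rewrite pc.
    by move=> a b hb ha hab; apply: m; exists a, b; split=> //; exact: sX.
  exists b; split.
    by rewrite pc => chi hchi; apply: (hb [set x | sat C chi (pval x)]);
        split=> //; exact: dfn_formula.
  exists a; split=> //; apply: (ha [set x | sat C (psi j) (pval x)]).
  by split=> //; exact: dfn_formula.
(* An automorphism over [M] moves the realization [b'] of [p] to the realization [a] equivalent to
   [b]; it carries the witness for [psi j] along, and this witness then serves for [b]. *)
have gsub (p q : TK) j : coset_rel_types pt H (set_val p) (set_val q) ->
    near p j -> near q j.
  move=> [a [b [ap bq /(coset_relP sH) hab]]] [b' [b'p [a' [ha' hab']]]].
  have [c pc] := TKP p; rewrite pc in ap b'p.
  move: ap b'p => /tp_formula_same ca /tp_formula_same cb'.
  have [s [t [sA sM Ht tM tb]]] := same_type_aut monC dG (small_countable Hk cM)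
    (same_type_trans (same_type_sym cb') ca).
  exists b; split=> //; exists (t a'); split.
    rewrite -Ht; exact: (proj2 (dfn_fixes _ sA sM (dfn_formula C (psi j))) ha').
  have := stH _ _ sA sM Ht _ hab'; rewrite tM (morphV tM) tb => h1.
  by have := subgroupM sH h1 hab; rewrite mulgA mulgVK.
move=> p q; split=> [pq|e].
  apply/funext => j; apply/asboolP/asboolP; first exact: gsub.
  apply: gsub; move: pq => [a [b [ap bq /(coset_relP sH) hab]]].
  exists b, a; split=> //; apply/(coset_relP sH).
  by have := subgroupV sH hab; rewrite invgM invgK.
have [c pc] := TKP p; have [d qd] := TKP q.
(* Each formula of [p] has [p] in its saturation, hence also [q] because the images agree;
   compactness then yields realizations of [p] and [q] in one coset. *)
have [||||||||a [b [ha hb hab]]] := @coset_compactness M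
  [set X | definable_over C M X /\ X (pt c)] [set Y | definable_over C M Y /\
    Y (pt d)] => //.
- by split=> //; exact: dfnT.
- by split=> //; exact: dfnT.
- by move=> X Y [dX Xc] [dY Yc]; split; first exact: dfnI.
- by move=> X Y [dX Xc] [dY Yc]; split; first exact: dfnI.
- by move=> X [].
- by move=> X [].
- move=> X Y [/dfn_pval[phi ->] Xc] [dY Yd].
  have : g p (code phi).
    apply/asboolP; exists c; split; first by rewrite pc => chi.
    by exists c; rewrite psi_code; split=> //; rewrite mulgV; exact: subgroup1.
  rewrite e => /asboolP[b [bq [a [ha hab]]]]; exists a, b; split=> //.
    by rewrite psi_code in ha.
  by move: bq; rewrite qd => /tp_formula_same; apply.
exists a, b; split; last exact/(coset_relP sH).
- by rewrite pc => chi hchi; apply: (ha [set x | sat C chi (pval x)]); split=>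
    //; exact: dfn_formula.
- by rewrite qd => chi hchi; apply: (hb [set x | sat C chi (pval x)]); split=>
    //; exact: dfn_formula.
Qed.

End TypeDefinableToSmooth.

Theorem corollary5p7 (L : language) (kappa U : Type) (C : structure L U)
    (n : nat) (G : groupType) (pt : G -> 'I_n -> U) (H K : set G) :
  countable_language L ->
  monster kappa C ->
  definable_group C pt ->
  subgroup H ->
  aut_invariant C (pt @` H) ->
  bounded_index kappa H ->
  subgroup K ->
  type_definable kappa C (pt @` K) ->
  H `<=` K ->
  (coset_rel_smooth C pt H K <-> type_definable kappa C (pt @` H)).
Proof.
move=> cL monC dG sH iH bH sK tK HK; split.
  by case=> M [cM eM sm];
      exact: (smooth_type_definable monC dG sH iH bH cM eM sK tK HK sm).
by move=> tH; exact: (type_definable_smooth K monC dG sH iH tH cL).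
Qed.
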